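(* Assume $m=ur+1$ for some positive integer $u$. Let $P_1\neq P_2$ be two rational places of $F$, different from $P_\infty$, which are totally ramified in $F/\mathbb{F}_q(x)$. Then $$|G(P_1,P_2)|=\frac{ur(r-1)(3ur^2-5ur+4r+4u-2)}{12}\quad\text{and}\quad |G(P_\infty,P_1)|=\frac{ur(r-1)(3ur^2-3ur+2r+2)}{12}.$$
   Context: Kummer setting: let $q$ be a power of a prime $p$, $m\ge 2$ an integer with $p\nmid m$, and $f(x)\in\mathbb{F}_q[x]$ a separable polynomial of degree $r$ with $\gcd(m,r)=1$. Let $F=\mathbb{F}_q(x,y)$ with $y^m=f(x)$; $F/\mathbb{F}_q(x)$ is a Kummer extension of degree $m$ with full constant field $\mathbb{F}_q$ and genus $g=(m-1)(r-1)/2$. $P_\infty$ denotes the unique place of $F$ over the pole of $x$ (it is rational and totally ramified). For each root $\alpha\in\mathbb{F}_q$ of $f$, the zero of $x-\alpha$ is totally ramified in $F/\mathbb{F}_q(x)$, and the place of $F$ over it is rational. Weierstrass semigroups: for distinct rational places $P_1,\dots,P_s$ of $F$, $H(P_1,\dots,P_s)=\{(n_1,\dots,n_s)\in\mathbb{N}^s : \exists z\in F \text{ with pole divisor } (z)_\infty=n_1P_1+\cdots+n_sP_s\}$ ($\mathbb{N}$ includes $0$), and $G(P_1,\dots,P_s)=\mathbb{N}^s\setminus H(P_1,\dots,P_s)$ is the set of gaps. *)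

(* Defs.v *)
From HB Require Import structures.
From mathcomp Require Import all_boot all_order all_algebra all_field.
Set Implicit Arguments. Unset Strict Implicit. Unset Printing Implicit Defensive.
Import Order.TTheory GRing.Theory Num.Theory.
Local Open Scope ring_scope.

Definition evalXY (K F : nzRingType) (iota : K -> F) (P : {poly {poly K}}) (a b : F) : F :=
  \sum_(i < size P) (\sum_(j < size P`_i) iota P`_i`_j * a ^+ j) * b ^+ i.

(* A place of F/K, given by its normalized discrete valuation v : F -> int
   (with the convention v 0 = 0; v is trivial on the constants K). *)
Definition is_place (K F : fieldType) (iota : K -> F) (v : F -> int) : Prop :=
  [/\ v 0 = 0,
      (forall c, c != 0 -> v (iota c) = 0),
      (forall a b, a != 0 -> b != 0 -> v (a * b) = v a + v b),
      (forall a b, a != 0 -> b != 0 -> a + b != 0 -> Num.min (v a) (v b) <= v (a + b))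
    & (exists t, t != 0 /\ v t = 1)].

(* Rational place: degree one, i.e. the residue field is K. *)
Definition is_rational_place (K F : fieldType) (iota : K -> F) (v : F -> int) : Prop :=
  is_place iota v /\
  (forall z, z != 0 -> 0 <= v z ->
     exists c, z = iota c \/ (z - iota c != 0 /\ 0 < v (z - iota c))).

(* Totally ramified in F/K(x) of degree m: the ramification index is m, i.e.
   v restricted to K(x)^* takes values in mZ. *)
Definition totally_ramified_over (K F : fieldType) (iota : K -> F) (x : F) (m : nat)
  (v : F -> int) : Prop :=
  forall p : {poly K}, p != 0 -> (m%:Z %| v (map_poly iota p).[x])%Z.

Definition polecoef (F : fieldType) (v : F -> int) (z : F) : nat :=
  if v z < 0 then absz (v z) else 0%N.

Definition inH2 (K F : fieldType) (iota : K -> F) (v1 v2 : F -> int) (n : nat * nat) : Prop :=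
  exists z : F,
    [/\ polecoef v1 z = n.1, polecoef v2 z = n.2 &
        forall w, is_place iota w -> w <> v1 -> w <> v2 -> polecoef w z = 0%N].

Definition num_gaps2 (K F : fieldType) (iota : K -> F) (v1 v2 : F -> int) (N : nat) : Prop :=
  exists s : seq (nat * nat),
    [/\ uniq s, (forall n, n \in s <-> ~ inH2 iota v1 v2 n) & size s = N].

(* Main.v *)
Require Import Defs.
From HB Require Import structures.
From mathcomp Require Import all_boot all_order all_algebra all_field.
From mathcomp Require Import zify ring.
From Stdlib Require Import Classical ClassicalEpsilon FunctionalExtensionality.
Set Implicit Arguments. Unset Strict Implicit. Unset Printing Implicit Defensive.

(** Every function is [z = \sum_(i < m) a_i y^i] with [a_i] in [K(x)]. At the point
    at infinity and at a ramified point the valuations of the terms [a_i y^i] are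
    distinct modulo [m], so the valuation of [z] is the minimum of those of its
    terms. At any other point [x = a] of an algebraic closure, the twists
    [y -> zeta y] by the [m]-th roots of unity permute the branches, so when [z] is
    regular there each term [a_i y^i] is regular too. Hence membership in a
    two-point semigroup is decided by the functions
    [(x - alpha1)^k1 (x - alpha2)^k2 y^i], which turns it into a condition on
    [(i, k1, k2)].

    The gaps at the two points are then indexed by a finite set carrying two
    injective functions [a] and [b], and a pair [n] is a gap iff for some index [g]
    one has [n.2 = b g] and [n.1 < a g], or [n.1 = a g] and [n.2 < b g]. Counting by
    inclusion-exclusion gives the sum of all [a g + b g] minus the number of
    inversions, and both orders are lexicographic when [m = u r + 1]. *)

(** * Counting pairs of gaps *)

(** The regularity of [z] is known only at places of [F] over [K], while the twists need [m]-th
    roots of unity, which [K] may lack. Instead of extending the constants of [F], each branch over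
    an algebraic closure is parametrised explicitly, [x = a + t^e] with [y] a power series given by
    Newton iteration; the order of vanishing along it, restricted to [F] and divided by its least
    positive value, is a place of [F/K].

    Regularity of each [a_i] at the finite points other than the two roots bounds the sum of its
    orders at these roots by its degree. So powers of [x - alpha1] and [x - alpha2] with the same
    two orders can replace [a_i] without making the pole at infinity worse.

    The shape [m = u r + 1] enters through [u r = -1] modulo [m], and through the equality of the
    ceilings of [r i / m] and [i / u] for [0 < i < m]; these turn the existence of exponents into
    explicit inequalities. *)

Section GapCount.

Lemma has_sum (I : eqType) (s : seq I) (P : pred I) : uniq s ->
  {in s &, forall g h, P g -> P h -> g = h} ->
  (has P s : nat) = \sum_(g <- s) P g.
Proof.
elim: s => [|g s IH] /=; first by rewrite big_nil.
move=> /andP[gs us] inj; rewrite big_cons -IH //; last first.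
  by move=> a b as_ bs; apply: inj; rewrite inE ?as_ ?bs orbT.
case: (boolP (P g)) => //= Pg; case: hasP => // -[h hs Ph].
by move: gs; rewrite (inj g h) ?inE ?eqxx ?hs ?orbT.
Qed.

Lemma sum_iota_eq B k (G : nat -> nat) : k < B -> \sum_(q <- iota 0 B) (q == k) * G q = G k.
Proof.
move=> kB; rewrite (bigD1_seq k) ?mem_iota ?iota_uniq //= eqxx mul1n big1 ?addn0 // => i /negPf ->.
by rewrite mul0n.
Qed.

Lemma sum_iota_lt B k : k <= B -> \sum_(q <- iota 0 B) (q < k) = k.
Proof.
move=> kB; rewrite -{1}(subnKC kB) iotaD big_cat /= add0n.
rewrite [X in _ + X]big1_seq ?addn0; last first.
  by move=> i /andP[_]; rewrite mem_iota => /andP[ki _]; rewrite ltnNge ki.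
rewrite (eq_big_seq (fun=> 1)); first by rewrite big_const_seq count_predT size_iota iter_addn_0 mul1n.
by move=> i; rewrite mem_iota /= => ->.
Qed.

Variables (I : eqType) (s : seq I) (a b : I -> nat).
Hypothesis us : uniq s.
Hypothesis inj_a : {in s &, injective a}.
Hypothesis inj_b : {in s &, injective b}.

(** By injectivity each family is a disjoint union of segments, horizontal ones of lengths [a g] and
    vertical ones of lengths [b g]. The horizontal segment of [g] can meet the vertical one of [h]
    only at [(a h, b g)], so the points counted twice are the inversions. *)
Lemma gap_count : exists G : seq (nat * nat),
  [/\ uniq G,
      forall n, n \in G <-> exists2 g, g \in s &
        (n.2 = b g /\ n.1 < a g) \/ (n.1 = a g /\ n.2 < b g)
    & size G + \sum_(g <- s) \sum_(h <- s) ((a h < a g) && (b g < b h) : nat)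
      = \sum_(g <- s) (a g + b g)].
Proof.
(* Only a common strict bound of all [a g] and [b g] is wanted, so that the counting takes place in
   a finite square. *)
pose B := (\sum_(g <- s) (a g + b g)).+1.
have bound g : g \in s -> a g < B /\ b g < B.
  move=> gs; rewrite /B (bigD1_seq g) //=; lia.
pose PA (n : nat * nat) := has (fun g => (n.2 == b g) && (n.1 < a g)) s.
pose PB (n : nat * nat) := has (fun g => (n.1 == a g) && (n.2 < b g)) s.
pose sq := [seq (p, q) | p <- iota 0 B, q <- iota 0 B].
pose G := [seq n <- sq | PA n || PB n].
have PAE n : (PA n : nat) = \sum_(g <- s) ((n.2 == b g) && (n.1 < a g)).
  apply: has_sum => // g h gs hs /andP[/eqP e _] /andP[/eqP e' _].
  by apply: inj_b => //; rewrite -e -e'.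
have PBE n : (PB n : nat) = \sum_(g <- s) ((n.1 == a g) && (n.2 < b g)).
  apply: has_sum => // g h gs hs /andP[/eqP e _] /andP[/eqP e' _].
  by apply: inj_a => //; rewrite -e -e'.
exists G; split.
- rewrite filter_uniq // allpairs_uniq ?iota_uniq //.
  by move=> [? ?] [? ?].
- move=> [p q]; rewrite mem_filter; split.
    case/andP=> /orP[/hasP[g gs /andP[/eqP e l]]|/hasP[g gs /andP[/eqP e l]]] _.
      by exists g => //; left.
    by exists g => //; right.
  case=> g gs /= h; have [ag bg] := bound g gs; apply/andP; split.
    by case: h => -[e l]; apply/orP; [left | right]; apply/hasP; exists g; rewrite //= e eqxx.
  apply/allpairsP; exists (p, q); rewrite !mem_iota /=; split=> //; lia.
have szG : size G = \sum_(n <- sq) (PA n || PB n : nat).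
  by rewrite size_filter -sum1_count big_mkcond; apply: eq_bigr => n _; case: (_ || _).
have inclexcl n : (PA n || PB n) + (PA n && PB n) = PA n + PB n :> nat.
  by case: (PA n); case: (PB n).
have sumA : \sum_(n <- sq) (PA n : nat) = \sum_(g <- s) a g.
  rewrite (eq_bigr _ (fun n _ => PAE n)) exchange_big /=; apply: eq_big_seq => g gs.
  have [ag bg] := bound g gs; rewrite big_allpairs /=.
  rewrite -[RHS](sum_iota_lt (ltnW ag)); apply: eq_bigr => p _.
  rewrite -(sum_iota_eq (fun=> p < a g) bg); apply: eq_bigr => q _.
  by case: (q == b g); case: (p < a g).
have sumB : \sum_(n <- sq) (PB n : nat) = \sum_(g <- s) b g.
  rewrite (eq_bigr _ (fun n _ => PBE n)) exchange_big /=; apply: eq_big_seq => g gs.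
  have [ag bg] := bound g gs; rewrite big_allpairs /= exchange_big /=.
  rewrite -[RHS](sum_iota_lt (ltnW bg)); apply: eq_bigr => p _.
  rewrite -(sum_iota_eq (fun=> p < b g) ag); apply: eq_bigr => q _.
  by case: (q == a g); case: (p < b g).
have sumAB : \sum_(n <- sq) (PA n && PB n : nat) =
    \sum_(g <- s) \sum_(h <- s) ((a h < a g) && (b g < b h)).
  have E n : (PA n && PB n : nat) = \sum_(g <- s) \sum_(h <- s)
      ((n.2 == b g) && (n.1 < a g)) * ((n.1 == a h) && (n.2 < b h)).
    by rewrite -mulnb PAE PBE big_distrlr.
  rewrite (eq_bigr _ (fun n _ => E n)) exchange_big /=; apply: eq_big_seq => g gs.
  rewrite exchange_big /=; apply: eq_big_seq => h hs.
  have [ag bg] := bound g gs; have [ah bh] := bound h hs; rewrite big_allpairs /=.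
  rewrite -(sum_iota_eq (fun p => (p < a g) && (b g < b h)) ah); apply: eq_bigr => p _.
  rewrite -(sum_iota_eq (fun q => (p == a h) * ((p < a g) && (q < b h))) bg).
  apply: eq_bigr => q _.
  by case: (q == b g); case: (p < a g); case: (p == a h); case: (q < b h).
rewrite szG -sumAB -big_split /= (eq_bigr _ (fun n _ => inclexcl n)) big_split /=.
by rewrite sumA sumB big_split.
Qed.

End GapCount.

(** * Sums over a triangle *)

(** The coordinate [c] stands for [n.+1 - j], where [-j] is an exponent of a linear factor. With
    this reversal an inversion becomes domination in both coordinates. *)
Definition tri u n := [seq (c, s) | c <- iota 1 n, s <- iota 1 (u * c)].

Lemma mem_tri u n p : (p \in tri u n) = (1 <= p.1 <= n) && (1 <= p.2 <= u * p.1).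
Proof.
case: p => c s /=; apply/allpairsPdep/idP => [[c' [s' [hc hs [-> ->]]]]|/andP[h1 h2]].
  by move: hc hs; rewrite !mem_iota; lia.
by exists c, s; rewrite !mem_iota; split=> //; lia.
Qed.

Lemma tri_uniq u n : uniq (tri u n).
Proof.
by rewrite allpairs_uniq_dep ?iota_uniq // => [c _|[? ?] [? ?] _ _ [-> ->]]; rewrite ?iota_uniq.
Qed.

Lemma sum_tri u n (G : nat * nat -> nat) :
  \sum_(p <- tri u n) G p = \sum_(c < n) \sum_(s < u * c.+1) G (c.+1, s.+1).
Proof.
rewrite big_allpairs_dep /= (iotaDl 1 0) big_map -val_enum_ord big_map big_enum /=.
apply: eq_bigr => c _; rewrite (iotaDl 1 0) big_map -val_enum_ord big_map big_enum /=.
by apply: eq_bigr.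
Qed.

Definition below (p q : nat * nat) := (q.1 <= p.1) && (q.2 <= p.2).

Lemma sum_ord_min a b : b <= a -> 2 * (\sum_(s < a) minn s.+1 b) + b * b = b + 2 * a * b.
Proof.
elim: a => [|a IH]; first by rewrite leqn0 => /eqP ->; rewrite big_ord0.
rewrite leq_eqVlt => /predU1P[->|ba].
  rewrite (eq_bigr (fun s : 'I_a.+1 => s.+1)); last by move=> s _; apply/minn_idPl.
  by elim: a.+1 => [|k IHk]; [rewrite big_ord0 | rewrite big_ord_recr /=; lia].
rewrite big_ord_recr /= (minn_idPr _) ?(ltnW ba) //; have := IH ba.
by move: (\sum_(s < a) _) => S; lia.
Qed.

Lemma count_below u n c s : c < n -> s < u * c.+1 ->
  \sum_(q <- tri u n) below (c.+1, s.+1) q = \sum_(d < c.+1) minn s.+1 (u * d.+1).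
Proof.
move=> cn su; rewrite sum_tri /below /= -(big_mkord predT (fun d => minn s.+1 (u * d.+1))).
rewrite -(big_mkord predT (fun d => \sum_(t < u * d.+1) ((d < c.+1) && (t < s.+1) : nat))).
rewrite (big_cat_nat (n := c.+1)) //= [X in _ + X]big_nat_cond.
rewrite [X in _ + X]big1 ?addn0; last first.
  move=> d /andP[/andP[cd _] _]; apply: big1 => t _; by rewrite ltnNge cd.
apply: eq_big_nat => d /andP[_ dc]; rewrite dc /=.
elim: (u * d.+1) => [|k IH]; first by rewrite big_ord0 minn0.
by rewrite big_ord_recr /= IH; case: ltnP; lia.
Qed.

Lemma sum_sqr a : 6 * (\sum_(d < a) d.+1 * d.+1) = a * a.+1 * (2 * a).+1.
Proof.
by elim: a => [|a IH]; [rewrite big_ord0 | rewrite big_ord_recr /= mulnDr IH; lia].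
Qed.

Lemma sum_succ a : 2 * (\sum_(d < a) d.+1) = a * a.+1.
Proof.
by elim: a => [|a IH]; [rewrite big_ord0 | rewrite big_ord_recr /= mulnDr IH; lia].
Qed.

Lemma tri_size u n : 2 * size (tri u n) = u * n * n.+1.
Proof.
rewrite -sum1_size sum_tri; elim: n => [|n IH]; first by rewrite big_ord0; lia.
by rewrite big_ord_recr /= mulnDr IH sum1_card card_ord; lia.
Qed.

Lemma tri_sum1 u n : 6 * (\sum_(p <- tri u n) p.1) = u * n * n.+1 * (2 * n).+1.
Proof.
rewrite sum_tri /=; elim: n => [|n IH]; first by rewrite big_ord0; lia.
by rewrite big_ord_recr /= mulnDr IH sum_nat_const card_ord; lia.
Qed.

Lemma tri_sum2 u n : 12 * (\sum_(p <- tri u n) p.2) =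
  u * u * n * n.+1 * (2 * n).+1 + 3 * u * n * n.+1.
Proof.
rewrite sum_tri /=; elim: n => [|n IH]; first by rewrite big_ord0; lia.
rewrite big_ord_recr /= mulnDr IH; have := sum_succ (u * n.+1).
by move: (\sum_(d < _) _) => S; lia.
Qed.

Lemma tri_below u n :
  12 * (\sum_(p <- tri u n) \sum_(q <- tri u n) below p q)
  = u * n * n.+1 * n.+2 * (u * n).+1.
Proof.
have -> : \sum_(p <- tri u n) \sum_(q <- tri u n) below p q =
    \sum_(c < n) \sum_(d < c.+1) \sum_(s < u * c.+1) minn s.+1 (u * d.+1).
  rewrite sum_tri; apply: eq_bigr => c _; rewrite [RHS]exchange_big.
  by apply: eq_bigr => s _; rewrite count_below.
elim: n => [|n IH]; first by rewrite big_ord0; lia.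
rewrite big_ord_recr /= mulnDr IH; set S := (X in 12 * X).
pose S1 := \sum_(d < n.+1) d.+1; pose S2 := \sum_(d < n.+1) d.+1 * d.+1.
(* Summing [sum_ord_min] over [d] expresses the new slice of the induction by sums of integers and
   of squares. *)
have E : 2 * S + u * u * S2 = (u + 2 * u * u * n.+1) * S1.
  rewrite /S1 /S2 !big_distrr -big_split /=; apply: eq_bigr => d _.
  have dn : u * d.+1 <= u * n.+1 by rewrite leq_mul2l ltn_ord orbT.
  have := sum_ord_min dn; move: (\sum_(s < _) _) => T; lia.
have h2 : 6 * S2 = n.+1 * n.+2 * (2 * n.+1).+1 := sum_sqr n.+1.
have h1 : 2 * S1 = n.+1 * n.+2 := sum_succ n.+1.
clearbody S S1 S2; have := congr1 (muln 6) E; rewrite mulnDr [6 * (_ * S2)]mulnCA h2.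
have -> : 6 * ((u + 2 * u * u * n.+1) * S1) = 3 * (u + 2 * u * u * n.+1) * (2 * S1) by lia.
rewrite h1; lia.
Qed.

Lemma sum_below_strict (s : seq (nat * nat)) : uniq s ->
  \sum_(p <- s) \sum_(q <- s) (below p q && (q != p)) + size s =
  \sum_(p <- s) \sum_(q <- s) below p q.
Proof.
move=> us; rewrite -sum1_size -big_split /=; apply: eq_big_seq => p ps.
rewrite [RHS](bigD1_seq p) //= [X in X + _](bigD1_seq p) //= eqxx andbF add0n addnC.
congr (_ + _); first by rewrite /below !leqnn.
by apply: eq_bigr => q /negPf ->; rewrite andbT.
Qed.

(** * Explicit gap sets and their cardinalities *)

Lemma ltn_mulB M i i' k k' : i < M -> i' < M -> 1 <= k -> 1 <= k' ->
  (M * k' - i' < M * k - i) = (k' < k) || (k' == k) && (i < i').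
Proof.
move=> hi hi' hk hk'; case: (ltngtP k' k) => [lt|lt|->] /=.
- have : M * k'.+1 <= M * k by rewrite leq_mul2l lt orbT.
  lia.
- have : M * k.+1 <= M * k' by rewrite leq_mul2l lt orbT.
  lia.
- have : M * 1 <= M * k by rewrite leq_mul2l hk orbT.
  lia.
Qed.

(** Put [r = n.+1], [m = u r + 1] and [i = u j + s]. The function [(x - alpha1)^(-j) y^i] has pole
    order [m j - i = (u n + 1) j - s] at the ramified point and [r i - m j = r s - j] at infinity:
    these are [b] and [a]. Each has the form [M k - i'] with [0 <= i' < M], hence is ordered
    lexicographically. *)
Lemma gaps_inf u n : exists G : seq (nat * nat),
  [/\ uniq G,
      forall N, N \in G <-> exists j s, [/\ 1 <= j <= n, 1 <= s <= u * (n.+1 - j) &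
        (N.2 = (u * n).+1 * j - s /\ N.1 < n.+1 * s - j) \/
        (N.1 = n.+1 * s - j /\ N.2 < (u * n).+1 * j - s)]
    & 12 * size G = u * n.+1 * n * (3 * u * n.+1 ^ 2 + 2 * n.+1 + 2 - 3 * u * n.+1)].
Proof.
pose a (p : nat * nat) := n.+1 * p.2 - (n.+1 - p.1).
pose b (p : nat * nat) := (u * n).+1 * (n.+1 - p.1) - p.2.
have ltA p q : p \in tri u n -> q \in tri u n ->
    (a q < a p) = (q.2 < p.2) || (q.2 == p.2) && (q.1 < p.1).
  rewrite !mem_tri /a; case: p q => c s [c' s'] /= /andP[h1 h2] /andP[h3 h4].
  rewrite ltn_mulB; [|lia..]; congr (_ || _ && _); lia.
have ltB p q : p \in tri u n -> q \in tri u n ->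
    (b p < b q) = (q.1 < p.1) || (q.1 == p.1) && (q.2 < p.2).
  rewrite !mem_tri /b; case: p q => c s [c' s'] /= /andP[h1 h2] /andP[h3 h4].
  have cn : u * c <= u * n by rewrite leq_mul2l; lia.
  have cn' : u * c' <= u * n by rewrite leq_mul2l; lia.
  rewrite ltn_mulB; [|lia..]; congr (_ || _ && _); lia.
have inj_a : {in tri u n &, injective a}.
  move=> p q hp hq e; have := ltA p q hp hq; have := ltA q p hq hp; rewrite e ltnn.
  by case: p q {e hp hq} => c s [c' s'] /= h1 h2; congr (_, _); lia.
have inj_b : {in tri u n &, injective b}.
  move=> p q hp hq e; have := ltB p q hp hq; have := ltB q p hq hp; rewrite e ltnn.
  by case: p q {e hp hq} => c s [c' s'] /= h1 h2; congr (_, _); lia.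
have [G [uG memG szG]] := gap_count (tri_uniq u n) inj_a inj_b.
exists G; split=> //.
- move=> N; rewrite memG; split.
    case=> -[c s]; rewrite mem_tri /a /b /= => /andP[h1 h2] h.
    by exists (n.+1 - c), s; rewrite subKn; [split=> //; lia | lia].
  case=> j [s [h1 h2 h]]; exists (n.+1 - j, s); first by rewrite mem_tri /=; lia.
  by rewrite /a /b /= subKn; [|lia].
have inv : \sum_(g <- tri u n) \sum_(h <- tri u n) ((a h < a g) && (b g < b h)) =
    \sum_(p <- tri u n) \sum_(q <- tri u n) (below p q && (q != p)).
  apply: eq_big_seq => p hp; apply: eq_big_seq => q hq; rewrite ltA // ltB // /below.
  by case: p q {hp hq} => c s [c' s']; rewrite xpair_eqE /=; congr nat_of_bool; lia.
(* Termwise, [a p + b p = n s + u n (n.+1 - c)], written without subtraction. *)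
have tot : \sum_(g <- tri u n) (a g + b g) + u * n * (\sum_(p <- tri u n) p.1) =
    n * (\sum_(p <- tri u n) p.2) + u * n * n.+1 * size (tri u n).
  rewrite -sum1_size !big_distrr -!big_split /=; apply: eq_big_seq => -[c s].
  rewrite mem_tri /a /b /= => /andP[h1 h2].
  have cn : u * c <= u * n by rewrite leq_mul2l; lia.
  have g1 : (u * n).+1 * 1 <= (u * n).+1 * (n.+1 - c) by rewrite leq_mul2l; lia.
  have g2 : n.+1 * 1 <= n.+1 * s by rewrite leq_mul2l; lia.
  have [e ce] : exists e, n.+1 = c + e by exists (n.+1 - c); lia.
  have -> : n.+1 - c = e by lia.
  move: g1 g2; have -> : n.+1 - c = e by lia.
  have -> : u * n * n.+1 * 1 = u * n * c + u * n * e by rewrite ce; lia.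
  lia.
have := sum_below_strict (tri_uniq u n); rewrite -inv.
move: szG tot (tri_size u n) (tri_sum1 u n) (tri_sum2 u n) (tri_below u n).
move: (\sum_(p <- _) p.1) (\sum_(p <- _) p.2) (\sum_(p <- _) (a p + b p)) => Sc Ss S.
move: (\sum_(p <- _) \sum_(q <- _) below p q) => Q.
move: (\sum_(p <- _) \sum_(q <- _) _) (size (tri u n)) (size G) => J T g.
move=> e1 e2 e3 e4 e5 e6 e7.
(* The multipliers are those that make the final identity linear in the monomials. *)
have f2 := congr1 (muln 12) e2.
have f3 := congr1 (muln (6 * u * n * n.+1)) e3.
have f4 := congr1 (muln (2 * u * n)) e4.
have f5 := congr1 (muln n) e5.
have -> : 3 * u * n.+1 ^ 2 + 2 * n.+1 + 2 - 3 * u * n.+1 = 3 * u * n.+1 * n + 2 * n.+1 + 2.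
  by lia.
lia.
Qed.

(** For [t < u], the numbers [i = u (j + k) - t] are those for which the ceiling of [i / u] is
    [j + k]. The orders are those of the poles of [(x - alpha1)^(-k) (x - alpha2)^(-j) y^i] at the
    two points, [m k - i] and [m j - i]; [I] is this [i]. *)
Lemma gaps_ram u n : exists G : seq (nat * nat),
  [/\ uniq G,
      forall N, N \in G <-> exists j k t,
        [/\ 1 <= j, 1 <= k, j + k <= n.+1, t < u &
        let m := (u * n.+1).+1 in
        (N.2 = m * j + t - u * (j + k) /\ N.1 < m * k + t - u * (j + k)) \/
        (N.1 = m * k + t - u * (j + k) /\ N.2 < m * j + t - u * (j + k))]
    & 12 * size G = u * n.+1 * n *
        (3 * u * n.+1 ^ 2 + 4 * n.+1 + 4 * u - (5 * u * n.+1 + 2))].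
Proof.
pose m := (u * n.+1).+1.
pose idx := [seq (p, t) | p <- tri 1 n, t <- iota 0 u].
have mem_idx (g : nat * nat * nat) : (g \in idx) =
    [&& 1 <= g.1.1 <= n, 1 <= g.1.2 <= g.1.1 & g.2 < u].
  case: g => -[c k] t; apply/allpairsP/idP => [[[p t'] [hp ht [-> ->]]]|].
    by move: hp ht; rewrite mem_tri mem_iota /=; lia.
  by move=> /= h; exists ((c, k), t); rewrite mem_tri mem_iota /=; split=> //; lia.
have uidx : uniq idx.
  by rewrite allpairs_uniq ?iota_uniq ?tri_uniq // => -[? ?] [? ?].
pose I (g : nat * nat * nat) := u * (n.+1 - g.1.1 + g.1.2) - g.2.
pose a (g : nat * nat * nat) := m * g.1.2 + g.2 - u * (n.+1 - g.1.1 + g.1.2).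
pose b (g : nat * nat * nat) := m * (n.+1 - g.1.1) + g.2 - u * (n.+1 - g.1.1 + g.1.2).
have I_bd (g : nat * nat * nat) : g \in idx -> [/\ 1 <= I g, I g < m, a g = m * g.1.2 - I g
     & b g = m * (n.+1 - g.1.1) - I g].
  rewrite mem_idx /I /a /b; case: g => -[c k] t /= /and3P[h1 h2 h3].
  have g1 : u * 1 <= u * (n.+1 - c + k) by rewrite leq_mul2l; lia.
  have g2 : u * (n.+1 - c + k) <= u * n.+1 by rewrite leq_mul2l; lia.
  by rewrite /m; split; lia.
have ltA (g h : nat * nat * nat) : g \in idx -> h \in idx ->
    (a h < a g) = (h.1.2 < g.1.2) || (h.1.2 == g.1.2) && (I g < I h).
  move=> hg hh; have [i1 i2 -> _] := I_bd g hg; have [i3 i4 -> _] := I_bd h hh.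
  by move: hg hh; rewrite !mem_idx => /and3P[h1 h2 h3] /and3P[h4 h5 h6]; apply: ltn_mulB; lia.
have ltB (g h : nat * nat * nat) : g \in idx -> h \in idx ->
    (b g < b h) = (h.1.1 < g.1.1) || (h.1.1 == g.1.1) && (I h < I g).
  move=> hg hh; have [i1 i2 _ ->] := I_bd g hg; have [i3 i4 _ ->] := I_bd h hh.
  move: hg hh; rewrite !mem_idx => /and3P[h1 h2 h3] /and3P[h4 h5 h6].
  by rewrite ltn_mulB; lia.
have ltI (g h : nat * nat * nat) : g \in idx -> h \in idx -> (I g < I h) =
    (n.+1 - g.1.1 + g.1.2 < n.+1 - h.1.1 + h.1.2) ||
    (n.+1 - g.1.1 + g.1.2 == n.+1 - h.1.1 + h.1.2) && (h.2 < g.2).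
  rewrite !mem_idx => /and3P[h1 h2 h3] /and3P[h4 h5 h6].
  by rewrite /I ltn_mulB; lia.
have inj_a : {in idx &, injective a}.
  move=> g h hg hh e; have := ltA g h hg hh; have := ltA h g hh hg.
  rewrite e ltnn !ltI //; move: hg hh; rewrite !mem_idx.
  case: g h {e} => -[c k] t [[c' k'] t'] /= /and3P[? ? ?] /and3P[? ? ?] ? ?.
  by congr (_, _, _); lia.
have inj_b : {in idx &, injective b}.
  move=> g h hg hh e; have := ltB g h hg hh; have := ltB h g hh hg.
  rewrite e ltnn !ltI //; move: hg hh; rewrite !mem_idx.
  case: g h {e} => -[c k] t [[c' k'] t'] /= /and3P[? ? ?] /and3P[? ? ?] ? ?.
  by congr (_, _, _); lia.
have [G [uG memG szG]] := gap_count uidx inj_a inj_b.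
exists G; split=> //.
- move=> N; rewrite memG; split.
    case=> -[[c k] t]; rewrite mem_idx /a /b /= => /and3P[h1 h2 h3] h.
    by exists (n.+1 - c), k, t; split=> //; lia.
  case=> j [k [t [h1 h2 h3 h4 h]]]; exists ((n.+1 - j, k), t).
    by rewrite mem_idx /=; lia.
  by rewrite /a /b /= subKn; [|lia].
(* Equal [(c, k)] would require both [I g < I h] and [I h < I g]. Otherwise domination in [(c, k)]
   decides alone, and the two values of [t] are free: this is the factor [u * u]. *)
have inv : \sum_(g <- idx) \sum_(h <- idx) ((a h < a g) && (b g < b h)) =
    u * u * (\sum_(p <- tri 1 n) \sum_(q <- tri 1 n) (below p q && (q != p))).
  have E : \sum_(g <- idx) \sum_(h <- idx) ((a h < a g) && (b g < b h)) =
      \sum_(g <- idx) \sum_(h <- idx) (below g.1 h.1 && (h.1 != g.1)).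
    apply: eq_big_seq => g hg; apply: eq_big_seq => h hh; rewrite ltA // ltB // !ltI //.
    move: hg hh; rewrite !mem_idx /below; case: g h => -[c k] t [[c' k'] t'] /=.
    move=> /and3P[? ? ?] /and3P[? ? ?]; rewrite xpair_eqE; congr nat_of_bool; lia.
  rewrite E big_allpairs big_distrr /=; apply: eq_bigr => p _.
  have F : \sum_(h <- idx) (below p h.1 && (h.1 != p)) =
      u * (\sum_(q <- tri 1 n) (below p q && (q != p))).
    rewrite big_allpairs big_distrr /=; apply: eq_bigr => q _.
    by rewrite big_const_seq count_predT size_iota iter_addn_0 mulnC.
  by rewrite F big_const_seq count_predT size_iota iter_addn_0 mulnC mulnA.
have sum_t : 2 * (\sum_(t <- iota 0 u) t) + u = u * u.
  rewrite -[u in iota 0 u]subn0 -/(index_iota 0 u) big_mkord.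
  by elim: (u) => [|v IH]; [rewrite big_ord0 | rewrite big_ord_recr /=; move: IH;
    move: (\sum_(i < v) _) => S; lia].
pose W := \sum_(p <- tri 1 n) (n.+1 - p.1 + p.2).
have hW : W + \sum_(p <- tri 1 n) p.1 = n.+1 * size (tri 1 n) + \sum_(p <- tri 1 n) p.2.
  rewrite /W -sum1_size big_distrr -!big_split /=; apply: eq_big_seq => -[c k].
  by rewrite mem_tri /= => /andP[h1 h2]; lia.
have tot : \sum_(g <- idx) (a g + b g) + 2 * u * u * W =
    m * u * W + size (tri 1 n) * (2 * (\sum_(t <- iota 0 u) t)).
  have -> : \sum_(g <- idx) (a g + b g) + 2 * u * u * W =
      \sum_(g <- idx) (a g + b g + 2 * u * (n.+1 - g.1.1 + g.1.2)).
    rewrite [RHS]big_split /=; congr (_ + _); rewrite big_allpairs /W big_distrr /=.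
    apply: eq_bigr => p _; rewrite big_const_seq count_predT size_iota iter_addn_0.
    by lia.
  rewrite -sum1_size big_distrl /W big_distrr -big_split /= big_allpairs.
  apply: eq_big_seq => -[c k] hp; rewrite mul1n big_distrr /=.
  have -> : m * u * (n.+1 - c + k) = \sum_(t <- iota 0 u) m * (n.+1 - c + k).
    by rewrite big_const_seq count_predT size_iota iter_addn_0; lia.
  rewrite -big_split /=; apply: eq_big_seq => t ht.
  have hg : ((c, k), t) \in idx by apply/allpairsP; exists ((c, k), t).
  have [i1 i2 -> ->] := I_bd _ hg; move: i1 i2; rewrite /I /=.
  move: hg; rewrite mem_idx /= => /and3P[h1 h2 h3].
  have m1 : m * 1 <= m * k by rewrite leq_mul2l; lia.
  have m2 : m * 1 <= m * (n.+1 - c) by rewrite leq_mul2l; lia.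
  by move: m1 m2; move: (n.+1 - c) => d; lia.
have := sum_below_strict (tri_uniq 1 n); rewrite inv in szG.
move: szG tot hW sum_t (tri_size 1 n) (tri_sum1 1 n) (tri_sum2 1 n) (tri_below 1 n).
move: (\sum_(p <- _) p.1) (\sum_(p <- tri 1 n) p.2) (\sum_(p <- idx) _) => Sc Ss S.
move: (\sum_(p <- _) \sum_(q <- _) below p q) => Q.
move: (\sum_(p <- _) \sum_(q <- _) _) (size (tri 1 n)) (size G) W => J T g W.
move: (\sum_(t <- _) t) => St.
rewrite /m => e1 e2 e3 e4 e5 e6 e7 e8 e9.
case: u {idx mem_idx uidx I a b I_bd ltA ltB ltI inj_a inj_b memG inv m} e1 e2 e4 => [|v] e1 e2 e4; first by lia.
have hSt : 2 * St = v.+1 * v by lia.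
have hW12 : 12 * W + 2 * n * n.+1 * (2 * n).+1 = 6 * n.+1 * n * n.+1 + 2 * n * n.+1 * n.+2 by lia.
have hW3 : 3 * W = n * n.+1 * n.+2 by lia.
have f1 := congr1 (muln (4 * v.+1 * (v.+1 * n.+1).+1)) hW3.
have f2 := congr1 (muln (8 * v.+1 * v.+1)) hW3.
have f3 := congr1 (muln (6 * v.+1 * v)) e5.
have f4 := congr1 (muln (v.+1 * v.+1)) e8.
have f5 := congr1 (muln (6 * v.+1 * v.+1)) e5.
have f6 := congr1 (muln (12 * v.+1 * v.+1)) e9.
rewrite hSt in e2.
have -> : 3 * v.+1 * n.+1 ^ 2 + 4 * n.+1 + 4 * v.+1 - (5 * v.+1 * n.+1 + 2) =
    3 * v.+1 * n * n + v.+1 * n + 2 * v.+1 + 4 * n + 2 by lia.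
lia.
Qed.

Import Order.TTheory GRing.Theory Num.Theory.
Local Open Scope ring_scope.

(** * Arithmetic of the semigroup conditions *)

Lemma divmod_uniq (m i i' : nat) (k k' : int) : (i < m)%N -> (i' < m)%N ->
  m%:Z * k + i%:Z = m%:Z * k' + i'%:Z -> k = k' /\ i = i'.
Proof.
move=> im im' e; have [h|[h|h]] : k = k' \/ k + 1 <= k' \/ k' + 1 <= k by lia.
- by split=> //; rewrite h in e; lia.
- have : m%:Z * (k + 1) <= m%:Z * k' by rewrite ler_pM2l //; lia.
  lia.
- have : m%:Z * (k' + 1) <= m%:Z * k by rewrite ler_pM2l //; lia.
  lia.
Qed.

(** Division rounded up: it finds the exponents for which [(x - alpha)^(-j) y^i] has a pole of order
    [n] at the point above [alpha]. *)
Lemma neg_divmod (m n : nat) : (0 < m)%N -> exists (i : nat) (j : nat),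
  (i < m)%N /\ n%:Z = m%:Z * j%:Z - i%:Z.
Proof.
move=> m0; have := divn_eq n m; have := ltn_pmod n m0.
move: (n %/ m)%N (n %% m)%N => q [|c] hc e; first by exists 0%N, q; lia.
by exists (m - c.+1)%N, q.+1; split; lia.
Qed.

(** Some [(x - alpha1)^k1 (x - alpha2)^k2 y^i] has pole order exactly [n1] at the first point, at
    most [n2] at the second, and no pole at infinity. For [n1 = 0] there is no pole to produce. *)
Definition ram_cond (m r n1 n2 : nat) := (0 < n1)%N ->
  exists (i : nat) (k1 k2 : int), [/\ (i < m)%N, m%:Z * k1 + i%:Z = - n1%:Z,
    - n2%:Z <= m%:Z * k2 + i%:Z & m%:Z * (k1 + k2) + r%:Z * i%:Z <= 0].

(** The equation [n1 = m j - i] forces [i] and [k1 = -j]. The largest [k2] allowed at infinity is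
    then [j] minus the ceiling of [r i / m], that is, of [i / u]. If it is nonnegative, the second
    point carries no pole; if it is [-k] with [k > 0], the condition fails exactly when
    [n2 < m k - i]. *)
Lemma not_ram_cond u n n1 n2 : (0 < u)%N -> let m := (u * n.+1).+1 in
  ~ ram_cond m n.+1 n1 n2 <-> exists j k t,
    [/\ 1 <= j, 1 <= k, j + k <= n.+1 & t < u]%N /\
    (n1 = m * j + t - u * (j + k) /\ n2 < m * k + t - u * (j + k))%N.
Proof.
move=> u0 m; split.
  move=> nc; have [n10 none] := imply_to_and _ _ nc.
  have [i [j [im nE]]] := neg_divmod n1 (ltn0Sn _ : (0 < m)%N).
  case: i im nE => [|i] im nE.
    case: none; exists 0%N, (- j%:Z), j%:Z; split=> //; lia.
  have := divn_eq i u; have := ltn_pmod i u0; set t := (i %/ u)%N; set c := (i %% u)%N => cu iE.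
  have tn : (t <= n)%N.
    rewrite leqNgt; apply/negP => nt; have : (u * n.+1 <= u * t)%N by rewrite leq_mul2l nt orbT.
    by move: im; rewrite /m; lia.
  (* Here [t.+1] is the ceiling of [i.+1 / u], and it is shown to be at least [r / m] times [i.+1].
     In the converse direction, [lo] is the matching lower estimate, which shows that [-k] cannot be
     increased. *)
  have key : m%:Z * - (t.+1)%:Z + n.+1%:Z * i.+1%:Z <= 0.
    have : (n.+1 * c.+1 <= n.+1 * u)%N by rewrite leq_mul2l cu orbT.
    by rewrite iE /m; lia.
  have [tj|jt] := leqP t.+1 j.
    case: none; exists i.+1, (- j%:Z), (j - t.+1)%:Z; split=> //; try lia.
      have : 0 <= m%:Z * (j - t.+1)%:Z by [].
      lia.
    by have -> : - j%:Z + (j - t.+1)%:Z = - t.+1%:Z by lia.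
  exists j, (t.+1 - j)%N, (u - c.+1)%N.
  have j0 : (1 <= j)%N by case: (j) nE => //; rewrite mulr0; lia.
  have [k kE] : exists k, t.+1 = (j + k)%N by exists (t.+1 - j)%N; lia.
  have -> : (t.+1 - j)%N = k by lia.
  have iE' : i.+1 = (u * (j + k) - (u - c.+1))%N.
    by rewrite -kE; rewrite iE; lia.
  have u1 : (u <= u * (j + k))%N by rewrite leq_pmulr //; lia.
  split; first by split; lia.
  split; first by lia.
  rewrite ltnNge; apply/negP => h; case: none.
  by exists i.+1, (- j%:Z), (- k%:Z); split=> //; lia.
case=> j [k [t [[j1 k1 jk tu] [n1E n2E]]]] cond.
have u1 : (u <= u * (j + k))%N by rewrite leq_pmulr //; lia.
have u2 : (u * (j + k) <= u * n.+1)%N by rewrite leq_mul2l jk orbT.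
have m1 : (m <= m * j)%N by rewrite leq_pmulr.
have n10 : (0 < n1)%N by rewrite n1E; move: m1; rewrite {1}/m; lia.
have [i [k1' [k2 [im e1 e2 e3]]]] := cond n10.
pose i0 := (u * (j + k) - t)%N.
have [k1E iE] : k1' = - j%:Z /\ i = i0.
  by apply: (divmod_uniq im); rewrite /i0 /m; move: m1 n1E; rewrite /m; lia.
have lo : m%:Z * (j + k - 1)%:Z < n.+1%:Z * i0%:Z.
  have : (n.+1 * t.+1 <= n.+1 * u)%N by rewrite leq_mul2l tu orbT.
  have -> : i0%:Z = u%:Z * (j + k)%:Z - t%:Z by rewrite /i0; lia.
  have -> : (j + k - 1)%:Z = (j + k)%:Z - 1 by lia.
  by rewrite /m; move: jk; move: (j + k)%N => w; lia.
have k2k : k2 <= - k%:Z.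
  rewrite leNgt; apply/negP => h.
  have : m%:Z * (1 - k%:Z) <= m%:Z * k2 by rewrite ler_pM2l //; lia.
  have E : (j + k - 1)%:Z = j%:Z + k%:Z - 1 by lia.
  by move: lo e3; rewrite E k1E iE; lia.
have : m%:Z * k2 <= m%:Z * - k%:Z by rewrite ler_pM2l //.
by move: e2 n2E; rewrite iE /i0; lia.
Qed.

(** The analogue for [(x - alpha1)^k y^i]: a pole of order exactly [n1] at the ramified point and at
    most [n0] at infinity. In [inf_cond0] the two points exchange roles. *)
Definition inf_cond1 (m r n0 n1 : nat) := (0 < n1)%N ->
  exists (i : nat) (k : int), [/\ (i < m)%N, m%:Z * k + i%:Z = - n1%:Z
    & m%:Z * k + r%:Z * i%:Z <= n0%:Z].

Definition inf_cond0 (m r n0 n1 : nat) := (0 < n0)%N ->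
  exists (i : nat) (k : int), [/\ (i < m)%N, m%:Z * k + r%:Z * i%:Z = n0%:Z
    & - n1%:Z <= m%:Z * k + i%:Z].

(** The substitution [i = u j + s] gives [r i - m j = r s - j]. Its positivity forces [s > 0], and
    [i <= u r] forces [s <= u (r - j)]. *)
Lemma inf_index u n i j : (0 < u)%N -> let m := (u * n.+1).+1 in (i < m)%N ->
  0 < n.+1%:Z * i%:Z - m%:Z * j%:Z -> (0 < j)%N ->
  exists s, [/\ (1 <= j <= n)%N, (1 <= s <= u * (n.+1 - j))%N,
    ((u * n).+1 * j - s)%N%:Z = m%:Z * j%:Z - i%:Z &
    (n.+1 * s - j)%N%:Z = n.+1%:Z * i%:Z - m%:Z * j%:Z].
Proof.
move=> u0 m im pos j0.
have jn : (j <= n)%N.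
  rewrite leqNgt; apply/negP => nj.
  have : (m * n.+1 <= m * j)%N by rewrite leq_mul2l nj orbT.
  have : (n.+1 * i <= n.+1 * (u * n.+1))%N by rewrite leq_mul2l; lia.
  by rewrite /m in pos *; lia.
have uj : (u * j < i)%N.
  rewrite ltnNge; apply/negP => h.
  have : (n.+1 * i <= n.+1 * (u * j))%N by rewrite leq_mul2l h orbT.
  by rewrite /m in pos; lia.
exists (i - u * j)%N.
have [s sE] : exists s, i = (u * j + s)%N by exists (i - u * j)%N; lia.
have -> : (i - u * j)%N = s by lia.
have [d dE] : exists d, n.+1 = (j + d)%N by exists (n.+1 - j)%N; lia.
have -> : (n.+1 - j)%N = d by lia.
have sd : (s <= u * d)%N by move: im; rewrite /m sE dE; lia.
have un : (u * d <= u * n)%N by rewrite leq_mul2l; lia.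
have D1 : ((u * n).+1 <= (u * n).+1 * j)%N by rewrite leq_pmulr.
have ns : (j <= n.+1 * s)%N by move: pos; rewrite sE /m; lia.
split; [lia | lia | |].
  by rewrite -subzn; [rewrite sE /m; lia | lia].
by rewrite -subzn //; rewrite sE /m; lia.
Qed.

Lemma not_inf_cond1 u n n0 n1 : (0 < u)%N -> let m := (u * n.+1).+1 in
  ~ inf_cond1 m n.+1 n0 n1 <-> exists j s,
    [/\ (1 <= j <= n)%N, (1 <= s <= u * (n.+1 - j))%N,
        n1 = ((u * n).+1 * j - s)%N & (n0 < n.+1 * s - j)%N].
Proof.
move=> u0 m; split.
  move=> nc; have [n10 none] := imply_to_and _ _ nc.
  have [i [j [im nE]]] := neg_divmod n1 (ltn0Sn _ : (0 < m)%N).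
  have j0 : (0 < j)%N by case: (j) nE => //; rewrite mulr0; lia.
  have lt : n0%:Z < n.+1%:Z * i%:Z - m%:Z * j%:Z.
    rewrite ltNge; apply/negP => h; apply: none; exists i, (- j%:Z); split=> //; lia.
  have [|s [h1 h2 h3 h4]] := inf_index u0 im _ j0; first by lia.
  by exists j, s; split=> //; lia.
case=> j [s [h1 h2 n1E n0E]] cond.
have un : (u * (n.+1 - j) <= u * n)%N by rewrite leq_mul2l; lia.
have D1 : ((u * n).+1 <= (u * n).+1 * j)%N by rewrite leq_pmulr //; lia.
have [|i [k [im e1 e2]]] := cond; first by lia.
have i0m : (u * j + s < m)%N by rewrite /m; have := mulnBr u n.+1 j; lia.
have [kE iE] : k = - j%:Z /\ i = (u * j + s)%N.
  apply: (divmod_uniq im) => //; rewrite e1 n1E -subzn; last by lia.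
  by rewrite /m; lia.
by move: e2 n0E; rewrite kE iE /m; lia.
Qed.

Lemma not_inf_cond0 u n n0 n1 : (0 < u)%N -> let m := (u * n.+1).+1 in
  ~ inf_cond0 m n.+1 n0 n1 <-> exists j s,
    [/\ (1 <= j <= n)%N, (1 <= s <= u * (n.+1 - j))%N,
        n0 = (n.+1 * s - j)%N & (n1 < (u * n).+1 * j - s)%N].
Proof.
move=> u0 m; split.
  move=> nc; have [n00 none] := imply_to_and _ _ nc.
  (* Modulo [m] the inverse of [r] is [-u], so the solution [i] of [r i = n0] is the residue of
     [-u n0]. *)
  have [i [J [im nE]]] := neg_divmod (u * n0) (ltn0Sn _ : (0 < m)%N).
  have e : m%:Z * (n0%:Z - n.+1%:Z * J%:Z) + n.+1%:Z * i%:Z = n0%:Z.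
    have -> : i%:Z = m%:Z * J%:Z - (u * n0)%N%:Z by lia.
    by rewrite /m; lia.
  move: e; set k := n0%:Z - _ => e.
  have lt : m%:Z * k + i%:Z < - n1%:Z.
    by rewrite ltNge; apply/negP => h; apply: none; exists i, k.
  have k0 : k < 0.
    rewrite ltNge; apply/negP => h.
    have : 0 <= m%:Z * k by rewrite mulr_ge0.
    lia.
  have [j jE] : exists j : nat, k = - j%:Z by exists `|k|%N; lia.
  rewrite jE in e lt k0.
  have [||s [h1 h2 h3 h4]] := @inf_index u n i j u0 im; [lia | lia |].
  by exists j, s; split=> //; move: h3 h4; rewrite -/m; lia.
case=> j [s [h1 h2 n0E n1E]] cond.
have un : (u * (n.+1 - j) <= u * n)%N by rewrite leq_mul2l; lia.
have D1 : ((u * n).+1 <= (u * n).+1 * j)%N by rewrite leq_pmulr //; lia.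
have ns : (n.+1 <= n.+1 * s)%N by rewrite leq_pmulr //; lia.
have [|i [k [im e1 e2]]] := cond; first by lia.
have i0m : (u * j + s < m)%N by rewrite /m; have := mulnBr u n.+1 j; lia.
have e1' : m%:Z * k + n.+1%:Z * i%:Z = - m%:Z * j%:Z + n.+1%:Z * (u * j + s)%N%:Z.
  by rewrite e1 n0E -subzn; [rewrite /m; lia | lia].
(* Multiplication by [u], with [u r = m - 1], turns both exponents of [y] into remainders modulo
   [m]. *)
have f : m%:Z * (u%:Z * k + i%:Z) + (u * j + s)%N%:Z =
    m%:Z * ((u * j + s)%N%:Z - u%:Z * j%:Z) + i%:Z.
  have := congr1 (fun z : int => u%:Z * z) e1'.
  by move: (u * j + s)%N => i0; rewrite /m; lia.
have [kE iE] := divmod_uniq i0m im f.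
have {}kE : k = - j%:Z.
  have : u%:Z * k = u%:Z * - j%:Z by rewrite -iE in kE; lia.
  by apply: mulfI; lia.
by move: e2 n1E; rewrite kE -iE /m; lia.
Qed.

(** * Places *)

Section PlaceTheory.

Variables (K F : fieldType) (iota : K -> F) (v : F -> int).
Hypothesis pv : is_place iota v.

Lemma place0 : v 0 = 0. Proof. by case: pv. Qed.

Lemma placeC c : c != 0 -> v (iota c) = 0.
Proof. by case: pv => _ + _ _ _; apply. Qed.

Lemma placeM a b : a != 0 -> b != 0 -> v (a * b) = v a + v b.
Proof. by case: pv => _ _ + _ _; apply. Qed.

Lemma place1 : v 1 = 0.
Proof.
have h := placeM (oner_neq0 F) (oner_neq0 F); rewrite mulr1 in h.
by move/eqP: h; rewrite -subr_eq0 opprD addNKr oppr_eq0 => /eqP.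
Qed.

Lemma placeN a : v (- a) = v a.
Proof.
have [->|a0] := eqVneq a 0; first by rewrite oppr0.
have N1 : (-1 : F) != 0 by rewrite oppr_eq0 oner_neq0.
have := placeM N1 N1; rewrite mulrNN mulr1 place1 => vN1.
by rewrite -mulN1r placeM //; lia.
Qed.

Lemma placeV a : v a^-1 = - v a.
Proof.
have [->|a0] := eqVneq a 0; first by rewrite invr0 place0 oppr0.
have ai0 : a^-1 != 0 by rewrite invr_eq0.
by apply/eqP; rewrite -addr_eq0 -placeM // mulVf // place1.
Qed.

Lemma placeX a n : a != 0 -> v (a ^+ n) = v a * n%:Z.
Proof.
move=> a0; elim: n => [|n IH]; first by rewrite expr0 place1 mulr0.
by rewrite exprS placeM ?expf_neq0 // IH; lia.
Qed.

Lemma placeXz a (k : int) : a != 0 -> v (a ^ k) = v a * k.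
Proof.
move=> a0; case: k => n; first by rewrite -exprnP placeX.
by rewrite NegzE -exprnN placeV placeX //; lia.
Qed.

(** The bound has to be nonpositive because [a + b] may vanish, and [v 0] is [0] by convention
    rather than infinite. *)
Lemma placeD_ge (n : int) a b :
  n <= 0 -> n <= v a -> n <= v b -> n <= v (a + b).
Proof.
move=> n0 na nb; have [->|ab0] := eqVneq (a + b) 0; first by rewrite place0.
have [->|a0] := eqVneq a 0; first by rewrite add0r.
have [->|b0] := eqVneq b 0; first by rewrite addr0.
case: pv => _ _ _ /(_ a b a0 b0 ab0) + _; apply: le_trans.
by rewrite le_min na nb.
Qed.

Lemma placeD_lt a b : a != 0 -> b != 0 -> v a < v b ->
  a + b != 0 /\ v (a + b) = v a.
Proof.
move=> a0 b0 vab; have ab0 : a + b != 0.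
  by rewrite addr_eq0; apply/eqP => ab; rewrite ab placeN ltxx in vab.
split=> //; case: pv => _ _ _ D _.
have h1 := D a b a0 b0 ab0.
have nb0 : - b != 0 by rewrite oppr_eq0.
have h2 := D (a + b) (- b) ab0 nb0; rewrite addrK placeN in h2.
have {}h2 := h2 a0.
move: h1 h2; rewrite !ge_min; lia.
Qed.

Lemma placeD_gt a b : a != 0 -> b != 0 -> v b < v a ->
  a + b != 0 /\ v (a + b) = v b.
Proof. by move=> a0 b0 vab; rewrite addrC; apply: placeD_lt. Qed.

(* The terms with the smallest valuation cannot cancel each other. *)
Lemma place_sum n (T : nat -> F) :
  (forall i j, (i < n)%N -> (j < n)%N -> i <> j ->
     T i != 0 -> T j != 0 -> v (T i) <> v (T j)) ->
  (exists i, (i < n)%N /\ T i != 0) ->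
  let S := \sum_(i < n) T i in
  [/\ S != 0,
      (exists i, [/\ (i < n)%N, T i != 0 & v S = v (T i)])
    & forall i, (i < n)%N -> T i != 0 -> v S <= v (T i)].
Proof.
elim: n => [|n IH] dist [i0 [i0n Ti0]] S; first by [].
rewrite /S big_ord_recr /= {S}.
have [|none] := classic (exists i, (i < n)%N /\ T i != 0); last first.
  have z i : (i < n)%N -> T i = 0.
    by move=> ilt; apply/eqP/negPn/negP => Ti; apply: none; exists i.
  have -> : \sum_(i < n) T i = 0 by apply: big1 => i _; apply: z.
  have i0E : i0 = n.
    case: (ltnP i0 n) => [/z T0|ge]; first by rewrite T0 eqxx in Ti0.
    by apply/eqP; rewrite eqn_leq ge andbT -ltnS.
  rewrite add0r; subst i0; split=> //; first by exists n.
  move=> i; rewrite ltnS leq_eqVlt => /predU1P[-> //|/z ->].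
  by rewrite eqxx.
move=> ex; have [] := IH _ ex.
  by move=> i j il jl; apply: dist; apply: ltnW; rewrite ltnS.
set S := \sum_(i < n) T i => S0 [i1 [i1n Ti1 vS]] minS.
have [Tn|Tn] := eqVneq (T n) 0.
  rewrite Tn addr0; split=> //; first by exists i1; rewrite ltnS ltnW.
  move=> i; rewrite ltnS leq_eqVlt => /predU1P[->|/minS //].
  by rewrite Tn eqxx.
have ne : v S <> v (T n).
  by rewrite vS; apply: dist => //; [rewrite ltnS ltnW | lia].
have [lt|ge] := ltP (v S) (v (T n)).
  have [s0 vs] := placeD_lt S0 Tn lt; rewrite vs; split=> //.
    by exists i1; rewrite ltnS ltnW.
  move=> i; rewrite ltnS leq_eqVlt => /predU1P[-> _|/minS //]; exact: ltW.
have lt : v (T n) < v S by lia.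
have [s0 vs] := placeD_gt S0 Tn lt; rewrite vs; split=> //.
  by exists n; rewrite ltnSn.
move=> i; rewrite ltnS leq_eqVlt => /predU1P[-> //|il Ti].
by have := minS i il Ti; lia.
Qed.

Lemma polecoef_eq0 z : polecoef v z = 0%N <-> 0 <= v z.
Proof. rewrite /polecoef; case: ltP; lia. Qed.

Lemma polecoefE z (n : nat) : (0 < n)%N -> polecoef v z = n <-> v z = - n%:Z.
Proof. rewrite /polecoef; case: ltP; lia. Qed.

Lemma polecoef_ge z (n : nat) : polecoef v z = n -> - n%:Z <= v z.
Proof. rewrite /polecoef; case: ltP; lia. Qed.

End PlaceTheory.

(** * Functions with prescribed poles at two places *)

Section TwoPoints.

Variables (K F : fieldType) (iota : K -> F) (v1 v2 : F -> int).

Definition regular_off (z : F) : Prop :=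
  forall w, is_place iota w -> w <> v1 -> w <> v2 -> 0 <= w z.

(** If neither function realises both orders, [T1] strictly dominates at the first place and [T2] at
    the second, so [T1 + T2] has both pole orders. If one order is zero, a single function
    suffices. *)
Lemma inH2_sum (n : nat * nat) (T1 T2 : F) :
  is_place iota v1 -> is_place iota v2 ->
  ((0 < n.1)%N ->
     [/\ v1 T1 = - n.1%:Z, - n.2%:Z <= v2 T1 & regular_off T1]) ->
  ((0 < n.2)%N ->
     [/\ v2 T2 = - n.2%:Z, - n.1%:Z <= v1 T2 & regular_off T2]) ->
  inH2 iota v1 v2 n.
Proof.
case: n => n1 n2 /= p1 p2 H1 H2.
have polereg z w : regular_off z -> is_place iota w -> w <> v1 -> w <> v2 ->
    polecoef w z = 0%N by move=> rz pw w1 w2; apply/polecoef_eq0/rz.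
have nz w z n : is_place iota w -> (0 < n)%N -> w z = - n%:Z -> z != 0.
  by move=> pw n0 wz; apply/eqP => z0; rewrite z0 (place0 pw) in wz; lia.
case: (posnP n1) => [n10|n10]; case: (posnP n2) => [n20|n20].
- exists 0; rewrite /polecoef /= (place0 p1) (place0 p2) n10 n20; split=> // w pw _ _.
  by rewrite (place0 pw).
- have [e2 e1 r] := H2 n20; exists T2; split=> /=; last by move=> w; apply: polereg.
    by rewrite n10; apply/polecoef_eq0; lia.
  by apply/polecoefE.
- have [e2 e1 r] := H1 n10; exists T1; split=> /=; last by move=> w; apply: polereg.
    by apply/polecoefE.
  by rewrite n20; apply/polecoef_eq0; lia.
have [e12 e11 r1] := H1 n10; have [e22 e21 r2] := H2 n20.
have T10 := nz _ _ _ p1 n10 e12; have T20 := nz _ _ _ p2 n20 e22.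
have [eq1|ne1] := eqVneq (v2 T1) (- n2%:Z).
  by exists T1; split=> /=; [apply/polecoefE | apply/polecoefE | move=> w; apply: polereg].
have [eq2|ne2] := eqVneq (v1 T2) (- n1%:Z).
  by exists T2; split=> /=; [apply/polecoefE | apply/polecoefE | move=> w; apply: polereg].
exists (T1 + T2); split=> /=.
- apply/polecoefE => //; rewrite -e12; apply: (proj2 (placeD_lt p1 T10 T20 _)).
  by move/eqP: ne2; lia.
- apply/polecoefE => //; rewrite -e22; apply: (proj2 (placeD_gt p2 T10 T20 _)).
  by move/eqP: ne1; lia.
- move=> w pw w1 w2; apply: polereg => // w' pw' w1' w2'.
  by apply: (placeD_ge pw') => //; [apply: r1 | apply: r2].
Qed.

End TwoPoints.

Lemma horner_map_MXaddC (A B : comNzRingType) (g : {rmorphism A -> B})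
    (q : {poly A}) c z :
  (map_poly g (q * 'X + c%:P)).[z] = (map_poly g q).[z] * z + g c.
Proof. by rewrite rmorphD rmorphM /= map_polyX map_polyC !hornerE. Qed.

(** * Values of polynomials at a place *)

Section PlacePoly.

Variables (K F : fieldType) (iota : {rmorphism K -> F}) (v : F -> int).
Hypothesis pv : is_place iota v.

Lemma placeM_ge0 a b : 0 <= v a -> 0 <= v b -> 0 <= v (a * b).
Proof.
have [->|a0] := eqVneq a 0; first by rewrite mul0r.
have [->|b0] := eqVneq b 0; first by rewrite mulr0.
by move=> va vb; rewrite (placeM pv) // addr_ge0.
Qed.

Lemma placeC_ge0 c : 0 <= v (iota c).
Proof.
by have [->|/(placeC pv) ->] := eqVneq c 0; first by rewrite rmorph0 (place0 pv).
Qed.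

Lemma place_horner_ge0 (p : {poly K}) s : 0 <= v s -> 0 <= v (map_poly iota p).[s].
Proof.
move=> vs; elim/poly_ind: p => [|p c IH]; first by rewrite rmorph0 horner0 (place0 pv).
rewrite horner_map_MXaddC.
by apply: (placeD_ge pv) => //; [apply: placeM_ge0 | apply: placeC_ge0].
Qed.

(** The residue of [s] is [c]. Equality is a separate case because [v 0 = 0] is not positive. *)
Definition meets (s : F) (c : K) := s = iota c \/ 0 < v (s - iota c).

Lemma meets_ge0 s c : meets s c -> 0 <= v s.
Proof.
case=> [->|h]; first exact: placeC_ge0.
rewrite -(subrK (iota c) s); apply: (placeD_ge pv) => //; first exact: ltW.
exact: placeC_ge0.
Qed.

Lemma meets_horner (p : {poly K}) s c : meets s c ->
  meets (map_poly iota p).[s] p.[c].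
Proof.
move=> h; have vs := meets_ge0 h.
case: (eqVneq (map_poly iota p).[s] (iota p.[c])) => [->|ne]; [by left|right].
have /factor_theorem[q qE] : root (p - p.[c]%:P) c by rewrite rootE !hornerE subrr.
have pE : (map_poly iota p).[s] - iota p.[c] = (map_poly iota q).[s] * (s - iota c).
  have := congr1 (fun u => (map_poly iota u).[s]) qE.
  by rewrite rmorphB rmorphM rmorphB /= map_polyX !map_polyC !hornerE.
case: h => [sE|h].
  by move: ne; rewrite -subr_eq0 pE sE subrr mulr0 eqxx.
have : (map_poly iota q).[s] * (s - iota c) != 0 by rewrite -pE subr_eq0.
rewrite mulf_eq0 negb_or => /andP[q0 s0].
rewrite pE (placeM pv) //; apply: ltr_wpDl => //.
exact: place_horner_ge0.
Qed.

Lemma meets_neq0 s c : meets s c -> c != 0 -> s != 0 /\ v s = 0.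
Proof.
case=> [->|h] c0; first by rewrite fmorph_eq0 c0 (placeC pv).
have ic0 : iota c != 0 by rewrite fmorph_eq0.
have vc := placeC pv c0.
have d0 : s - iota c != 0 by apply/eqP => d0; rewrite d0 (place0 pv) in h.
rewrite -(subrK (iota c) s) -vc; apply: (placeD_gt pv) => //.
by rewrite vc.
Qed.

Lemma meets_inj s c c' : meets s c -> meets s c' -> c = c'.
Proof.
move=> h h'; apply/eqP; rewrite -subr_eq0; apply/negPn/negP => cc'.
have := meets_horner ('X - c'%:P) h.
rewrite rmorphB /= map_polyX map_polyC !hornerE => /meets_neq0 /(_ cc')[ne v0].
by case: h' => [E|]; [rewrite E subrr eqxx in ne | rewrite v0].
Qed.

Lemma place_horner_root (s : F) (c : K) (p : {poly K}) :
  0 < v (s - iota c) -> p != 0 ->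
  v (map_poly iota p).[s] = v (s - iota c) * (mup c p)%:Z.
Proof.
move=> h p0; have [n [q qc pE]] := multiplicity_XsubC p c.
rewrite p0 /= in qc.
have s0 : s - iota c != 0 by apply/eqP => d0; rewrite d0 (place0 pv) in h.
have mE : mup c p = n.
  by rewrite pE mupMr // mup_XsubCX eqxx.
rewrite mE pE rmorphM rmorphXn rmorphB /= map_polyX map_polyC !hornerE.
have [q0 vq] : (map_poly iota q).[s] != 0 /\ v (map_poly iota q).[s] = 0.
  by apply: meets_neq0 (qc) ; apply: meets_horner; right.
by rewrite (placeM pv) ?expf_neq0 // vq (placeX pv) // add0r.
Qed.

Lemma place_horner_pole (s : F) (p : {poly K}) :
  v s < 0 -> p != 0 ->
  (map_poly iota p).[s] != 0 /\ v (map_poly iota p).[s] = v s * (size p).-1%:Z.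
Proof.
move=> h; have s0 : s != 0 by apply/eqP => d0; rewrite d0 (place0 pv) in h.
elim/poly_ind: p => [|p c IH]; first by rewrite eqxx.
have [->|p0] := eqVneq p 0.
  rewrite mul0r add0r polyC_eq0 => c0; rewrite map_polyC hornerC size_polyC c0.
  by rewrite fmorph_eq0 c0 (placeC pv) // mulr0.
move=> _; have [q0 vq] := IH p0.
have sz : size (p * 'X + c%:P) = (size p).+1 by rewrite size_MXaddC (negPf p0).
rewrite sz horner_map_MXaddC.
have pp : (0 < size p)%N by rewrite size_poly_gt0.
have vE : v ((map_poly iota p).[s] * s) = v s * (size p)%:Z.
  by rewrite (placeM pv) // vq; move: pp; case: (size p) => //= k _; lia.
have ne : (map_poly iota p).[s] * s != 0 by rewrite mulf_neq0.
have [->|c0] := eqVneq c 0; first by rewrite raddf0 addr0.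
rewrite -vE; apply: (placeD_lt pv) => //; first by rewrite fmorph_eq0.
by rewrite (placeC pv) // vE; nia.
Qed.

End PlacePoly.

(** * The curve and its totally ramified places *)

Section Curve.

Variables (K F : fieldType) (iota : {rmorphism K -> F}) (x y : F).

Definition psi : {rmorphism {poly K} -> F} := horner_eval x \o map_poly iota.
Definition ev : {rmorphism {poly {poly K}} -> F} := horner_eval y \o map_poly psi.

Arguments psi : simpl never.
Arguments ev : simpl never.

Lemma psiE p : psi p = (map_poly iota p).[x].
Proof. by []. Qed.

Lemma evE P : ev P = (map_poly psi P).[y].
Proof. by []. Qed.

Lemma evC p : ev p%:P = psi p.
Proof. by rewrite evE map_polyC hornerC. Qed.

Lemma evX : ev 'X = y.
Proof. by rewrite evE map_polyX hornerX. Qed.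

Lemma psiC c : psi c%:P = iota c.
Proof. by rewrite psiE map_polyC hornerC. Qed.

Lemma psiX : psi 'X = x.
Proof. by rewrite psiE map_polyX hornerX. Qed.

Lemma psiXsubC c : psi ('X - c%:P) = x - iota c.
Proof. by rewrite rmorphB psiX psiC. Qed.

Lemma ev_wide n (P : {poly {poly K}}) : (size P <= n)%N -> ev P = \sum_(i < n) psi P`_i * y ^+ i.
Proof.
move=> Pn; rewrite evE (@horner_coef_wide _ n) //.
  by apply: eq_bigr => i _; rewrite coef_map.
by rewrite (leq_trans _ Pn) // size_poly.
Qed.

Lemma evalXYE P : evalXY iota P x y = ev P.
Proof.
rewrite /evalXY (ev_wide (leqnn _)); apply: eq_bigr => i _; congr (_ * _).
rewrite psiE (@horner_coef_wide _ (size P`_i)) ?size_poly //.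
by apply: eq_bigr => j _; rewrite coef_map.
Qed.

Variables (m r : nat) (f : {poly K}).
Hypothesis m_gt0 : (0 < m)%N.
Hypothesis f_sep : separable_poly f.
Hypothesis f_size : size f = r.+1.
Hypothesis co_mr : coprime m r.
Hypothesis psi_neq0 : forall p : {poly K}, p != 0 -> psi p != 0.
Hypothesis y_eq : y ^+ m = psi f.
Hypothesis generated : forall z, exists P Q, ev Q != 0 /\ z = ev P / ev Q.

Let f0 : f != 0. Proof. by rewrite -size_poly_eq0 f_size. Qed.

Lemma y_neq0 : y != 0.
Proof. by have := psi_neq0 f0; rewrite -y_eq expf_eq0 m_gt0. Qed.

Definition curve_poly : {poly {poly K}} := 'X^m - f%:P.

Lemma curve_poly_monic : curve_poly \is monic.
Proof. by rewrite /curve_poly monicXnsubC. Qed.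

Lemma ev_curve_poly : ev curve_poly = 0.
Proof. by rewrite rmorphB rmorphXn evX evC y_eq subrr. Qed.

Lemma reduce (P : {poly {poly K}}) :
  exists Q A, [/\ P = Q * curve_poly + A, (size A <= m)%N & ev A = ev P].
Proof.
have PE := Pdiv.RingMonic.rdivp_eq curve_poly_monic P.
exists (Pdiv.Ring.rdivp P curve_poly), (Pdiv.Ring.rmodp P curve_poly); split=> //.
  have := Pdiv.Ring.ltn_rmodp P curve_poly.
  by rewrite (monic_neq0 curve_poly_monic) size_XnsubC.
by rewrite [in RHS]PE rmorphD rmorphM ev_curve_poly mulr0 add0r.
Qed.

(** A substitute for the norm: [ev P] is integral over [K[x]], and once the factors ['X] are
    stripped from an integral relation, its nonzero constant term is a multiple of [ev P]. *)
Lemma ev_norm (P : {poly {poly K}}) : ev P != 0 -> exists (Q : {poly {poly K}}) (N : {poly K}), N != 0 /\ ev P * ev Q = psi N.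
Proof.
move=> P0; have [q q_mon q_root] : integralOver psi (ev P).
  rewrite evE; apply: integral_horner.
    apply/integral_poly => i; rewrite coef_map; exact: integral_id.
  exists curve_poly; first exact: curve_poly_monic.
  by rewrite rootE; apply/eqP; exact: ev_curve_poly.
have {q_mon} : q != 0 by apply: monic_neq0.
move/eqP: q_root; elim/poly_ind: q => [|q c IH]; first by rewrite eqxx.
rewrite horner_map_MXaddC => E.
have [c0|c0] := eqVneq c 0.
  move: E; rewrite c0 rmorph0 !addr0 => /eqP; rewrite mulf_eq0 (negPf P0) orbF => /eqP E.
  by rewrite mulf_eq0 negb_or => /andP[q0 _]; apply: IH.
move=> _; exists (- (map_poly polyC q).[P]), c; split=> //.
rewrite rmorphN mulrN; apply/eqP; rewrite eq_sym -addr_eq0 addrC -E eq_sym addrC.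
rewrite addrC; apply/eqP; congr (_ + _); rewrite mulrC; congr (_ * _).
rewrite -[in RHS]horner_map -map_poly_comp; congr (_.[_]).
by apply: eq_map_poly => p; exact: (esym (evC p)).
Qed.

Lemma normal_form z : exists (A : {poly {poly K}}) (D : {poly K}),
  [/\ (size A <= m)%N, D != 0 & z = ev A / psi D].
Proof.
have [P [Q [Q0 ->]]] := generated z.
have [Q' [N [N0 QN]]] := ev_norm Q0.
have [_ [A [_ Am AE]]] := reduce (P * Q').
exists A, N; split=> //; rewrite AE rmorphM -QN.
have : ev Q * ev Q' != 0 by rewrite QN psi_neq0.
rewrite mulf_eq0 negb_or => /andP[_ Q'0].
by rewrite invfM mulrACA divff // mulr1.
Qed.

(** After division by [e] the terms have values congruent to [d i] modulo [m], which differ since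
    [d] is prime to [m] and [i < m]. The factor [e] is kept because the value of [y] is at first
    known only up to a positive multiple. *)
Lemma ev_valuation (v : F -> int) (kappa : {poly K} -> int) (d e : int)
    (A : {poly {poly K}}) :
  is_place iota v -> 0 < e -> coprime m `|d| ->
  (forall p : {poly K}, p != 0 -> v (psi p) = e * (m%:Z * kappa p)) -> v y = e * d ->
  A != 0 -> (size A <= m)%N ->
  [/\ ev A != 0,
      (exists i, [/\ (i < m)%N, A`_i != 0
                  & v (ev A) = e * (m%:Z * kappa A`_i + d * i%:Z)])
    & forall i, A`_i != 0 -> v (ev A) <= e * (m%:Z * kappa A`_i + d * i%:Z)].
Proof.
move=> pv e0 co vpsi vy A0 Am.
have T0 i : (psi A`_i * y ^+ i != 0) = (A`_i != 0).
  rewrite mulf_eq0 negb_or expf_neq0 ?y_neq0 // andbT.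
  have [->|n0] := eqVneq A`_i 0; first by rewrite rmorph0 eqxx.
  by rewrite psi_neq0.
have vT i : A`_i != 0 -> v (psi A`_i * y ^+ i) = e * (m%:Z * kappa A`_i + d * i%:Z).
  move=> ai; rewrite (placeM pv) ?psi_neq0 ?expf_neq0 ?y_neq0 //.
  by rewrite (placeX pv) ?y_neq0 // vpsi // vy; lia.
rewrite (ev_wide Am).
have [] := @place_sum K F iota v pv m (fun i => psi A`_i * y ^+ i).
- move=> i j im jm ij; rewrite !T0 => ai aj; rewrite !vT // => E.
  have {}E : m%:Z * kappa A`_i + d * i%:Z = m%:Z * kappa A`_j + d * j%:Z.
    by apply: (mulfI (lt0r_neq0 e0)).
  have : (m%:Z %| d * (i%:Z - j%:Z))%Z.
    apply/dvdzP; exists (kappa A`_j - kappa A`_i); lia.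
  rewrite Gauss_dvdzr; last by rewrite /coprimez /gcdz /=; rewrite /coprime in co; rewrite (eqP co).
  move=> /dvdzP[k kE]; have [k0|[k0|k0]] : k = 0 \/ 1 <= k \/ k <= -1 by lia.
  - by rewrite k0 mul0r in kE; lia.
  - by nia.
  - by nia.
- exists (size A).-1; rewrite T0 -lead_coefE lead_coef_eq0; split=> //.
  by move: Am; rewrite -size_poly_gt0 in A0; lia.
move=> S0 [i0 [im Ti vS]] minS; split=> //.
  by exists i0; rewrite -T0; split=> //; rewrite vS vT // -T0.
move=> i ai; rewrite -vT //; apply: minS; last by rewrite T0.
by apply: leq_trans Am; rewrite ltnNge; apply: contra ai => /(nth_default 0) ->.
Qed.

(** Here [kappa] plays the part of the valuation of [K(x)] below [v], with ramification index [m].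
    Through the minimum formula, [kappa] and [d] determine [v]. *)
Definition valued v (kappa : {poly K} -> int) d :=
  [/\ is_place iota v, coprime m `|d|,
      (forall p : {poly K}, p != 0 -> v (psi p) = m%:Z * kappa p) & v y = d].

Lemma valued_place v kappa d : valued v kappa d -> is_place iota v.
Proof. by case. Qed.

Lemma valued_psi v kappa d (p : {poly K}) : valued v kappa d -> p != 0 -> v (psi p) = m%:Z * kappa p.
Proof. by case=> _ _ + _; apply. Qed.

Lemma valued_y v kappa d : valued v kappa d -> v y = d.
Proof. by case. Qed.

(** By the minimum formula every value is a multiple of [e], and a place takes the value 1. *)
Lemma valued_normalize (v : F -> int) (kappa : {poly K} -> int) (d e : int) :
  is_place iota v -> 0 < e -> coprime m `|d| ->
  (forall p : {poly K}, p != 0 -> v (psi p) = e * (m%:Z * kappa p)) -> v y = e * d ->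
  valued v kappa d.
Proof.
move=> pv e0 co vpsi vy; suff e1 : e = 1.
  by split=> //; [move=> p p0; rewrite vpsi // e1 mul1r | rewrite vy e1 mul1r].
have [t [t0 vt]] : exists t, t != 0 /\ v t = 1 by case: pv.
have [A [D [Am D0 tE]]] := normal_form t.
have A0 : A != 0 by apply: contra t0 => /eqP A0; rewrite tE A0 rmorph0 mul0r.
have [evA0 [i [_ _ vA]] _] := ev_valuation pv e0 co vpsi vy A0 Am.
move: vt; rewrite tE (placeM pv) ?invr_eq0 ?psi_neq0 // (placeV pv) vA vpsi //.
rewrite -mulrBr; move: (_ - _) => X h; have X1 : 1 <= X by nia.
by nia.
Qed.

Lemma valued_min v kappa d (A : {poly {poly K}}) (D : {poly K}) :
  valued v kappa d -> A != 0 -> (size A <= m)%N -> D != 0 ->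
  [/\ ev A / psi D != 0,
      (exists i, [/\ (i < m)%N, A`_i != 0
         & v (ev A / psi D) = m%:Z * (kappa A`_i - kappa D) + d * i%:Z])
    & forall i, A`_i != 0 ->
        v (ev A / psi D) <= m%:Z * (kappa A`_i - kappa D) + d * i%:Z].
Proof.
case=> pv co vpsi vy A0 Am D0.
have vpsi1 (p : {poly K}) : p != 0 -> v (psi p) = 1 * (m%:Z * kappa p) by rewrite mul1r; apply: vpsi.
have vy1 : v y = 1 * d by rewrite mul1r.
have [evA0 [i [im Ai vA]] mA] := ev_valuation pv (ltr01) co vpsi1 vy1 A0 Am.
have pD := psi_neq0 D0.
have E : v (ev A / psi D) = v (ev A) - m%:Z * kappa D.
  by rewrite (placeM pv) ?invr_eq0 // (placeV pv) vpsi.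
rewrite E mulf_neq0 ?invr_eq0 //; split=> //.
  by exists i; split=> //; rewrite vA; lia.
by move=> j Aj; have := mA j Aj; lia.
Qed.

Lemma valued_uniq v v' kappa d : valued v kappa d -> valued v' kappa d -> v = v'.
Proof.
move=> h h'; apply: functional_extensionality => z.
have [A [D [Am D0 ->]]] := normal_form z.
have [->|A0] := eqVneq A 0.
  by rewrite rmorph0 mul0r (place0 (valued_place h)) (place0 (valued_place h')).
have [_ [i [_ Ai e]] l] := valued_min h A0 Am D0.
have [_ [i' [_ Ai' e']] l'] := valued_min h' A0 Am D0.
by have := l _ Ai'; have := l' _ Ai; lia.
Qed.

Definition kappa_inf (p : {poly K}) : int := - (size p).-1%:Z.
Definition kappa_at (a : K) (p : {poly K}) : int := (mup a p)%:Z.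

(** From [m v(y) = r v(x)] and coprimality, [m] divides [v x]; minus the quotient is the factor [e]
    to be normalised. *)
Lemma valued_inf v : is_place iota v -> v x < 0 -> valued v kappa_inf (- r%:Z).
Proof.
move=> pv vx; have vpsi (p : {poly K}) : p != 0 -> v (psi p) = v x * (size p).-1%:Z.
  by move=> p0; exact: (proj2 (place_horner_pole pv vx p0)).
have vy : v y * m%:Z = v x * r%:Z.
  by rewrite -(placeX pv) ?y_neq0 // y_eq vpsi // f_size.
have /dvdzP[k kE] : (m%:Z %| v x)%Z.
  rewrite -(@Gauss_dvdzl _ _ r%:Z); first by rewrite -vy dvdz_mull.
  by rewrite /coprimez /gcdz /=; have := co_mr; rewrite /coprime => /eqP ->.
have k0 : 0 < - k by nia.
apply: (valued_normalize pv k0).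
- by rewrite abszN.
- by move=> p p0; rewrite vpsi // kE /kappa_inf; lia.
by apply: (@mulIf _ m%:Z); first (by lia); rewrite vy kE; lia.
Qed.

Lemma mup_root (a : K) : root f a -> mup a f = 1%N.
Proof.
move=> fa; apply/eqP; rewrite eqn_leq.
have := fa; rewrite -dvdp_XsubCl XsubC_dvd // => ->; rewrite andbT.
rewrite mup_leq //; apply/negP.
by rewrite (separable_nosquare f_sep) // size_XsubC.
Qed.

Lemma valued_root v (a : K) : is_place iota v -> root f a -> 0 < v (x - iota a) ->
  valued v (kappa_at a) 1.
Proof.
move=> pv fa vx.
have vpsi (p : {poly K}) : p != 0 -> v (psi p) = v (x - iota a) * (mup a p)%:Z.
  exact: place_horner_root.
have vy : v y * m%:Z = v (x - iota a).
  by rewrite -(placeX pv) ?y_neq0 // y_eq vpsi // mup_root // mulr1.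
have vy0 : 0 < v y by nia.
apply: (valued_normalize pv vy0).
- exact: coprimen1.
- by move=> p p0; rewrite vpsi // -vy /kappa_at; lia.
by rewrite mulr1.
Qed.

(** Ramification excludes any further relation between [x] and [y]: the terms of a nonzero remainder
    have distinct values and cannot cancel. *)
Lemma ev_eq0 v kappa d (P : {poly {poly K}}) :
  valued v kappa d -> ev P = 0 -> exists Q, P = Q * curve_poly.
Proof.
move=> h P0; have [Q [A [PE Am AE]]] := reduce P.
exists Q; rewrite PE; have [->|A0] := eqVneq A 0; first by rewrite addr0.
have [+ _ _] := valued_min h A0 Am (oner_neq0 {poly K}).
by rewrite AE P0 mul0r eqxx.
Qed.

(* Above [x = c] with [f.[c] != 0], the function [x - c] divides [y - d] up to a
   unit, so the values of [v] are multiples of [v (x - c)]. *)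
Lemma unramified v c d : is_place iota v -> m%:R != 0 :> K -> ~~ root f c ->
  0 < v (x - iota c) -> meets iota v y d ->
  forall P : {poly {poly K}}, ev P != 0 -> (v (x - iota c) %| v (ev P))%Z.
Proof.
move=> pv m0 fc vx vyd.
have vx0 : meets iota v x c by right.
have xc0 : x - iota c != 0 by apply/eqP => d0; rewrite d0 (place0 pv) in vx.
have fE : f.[c] = d ^+ m.
  apply: (meets_inj pv (s := y ^+ m)).
    by rewrite y_eq; apply: meets_horner.
  have := meets_horner pv 'X^m vyd.
  by rewrite map_polyXn !hornerXn.
have d0 : d != 0.
  by apply: contra fc => /eqP d0; rewrite rootE fE d0 expr0n gtn_eqF.
have /factor_theorem[g gE] : root (f - f.[c]%:P) c by rewrite rootE !hornerE subrr.
have /factor_theorem[h hE] : root ('X^m - (d ^+ m)%:P) d.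
  by rewrite rootE hornerD hornerN hornerXn hornerC subrr.
(* The value [h.[d]] is the derivative [m d^(m-1)] of ['X^m] at [d]; this makes [H] a unit at the
   place. *)
have hd : h.[d] != 0.
  have := congr1 (fun q => q^`().[d]) hE.
  rewrite derivB derivXn derivC subr0 derivM derivXsubC mulr1 hornerD hornerM.
  rewrite hornerXsubC subrr mulr0 add0r hornerMn hornerXn => <-.
  by rewrite -mulr_natr mulf_neq0 // expf_neq0.
pose H : {poly {poly K}} := map_poly polyC h.
have evH : ev H = (map_poly iota h).[y].
  rewrite /H evE -map_poly_comp; congr (_.[_]).
  by apply: eq_map_poly => a; exact: psiC.
have [H0 vH] : ev H != 0 /\ v (ev H) = 0.
  by rewrite evH; apply: meets_neq0 (meets_horner pv h vyd) hd.
have rel : ev H * (y - iota d) = psi g * (x - iota c).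
  have e1 : ev H * (y - iota d) = y ^+ m - iota (d ^+ m).
    rewrite evH; have := congr1 (fun q => (map_poly iota q).[y]) hE.
    rewrite !rmorphB !rmorphM !rmorphB /= map_polyXn map_polyX !map_polyC.
    by rewrite hornerD hornerN hornerXn hornerM hornerXsubC hornerC => ->.
  have e2 : psi g * (x - iota c) = psi f - iota f.[c].
    by rewrite -psiXsubC -rmorphM -gE rmorphB psiC.
  by rewrite e1 e2 y_eq fE.
have ev_ge0 P : 0 <= v (ev P).
  elim/poly_ind: P => [|P p IH]; first by rewrite rmorph0 (place0 pv).
  rewrite rmorphD rmorphM evX evC; apply: (placeD_ge pv) => //.
    by apply: (placeM_ge0 pv) => //; apply: meets_ge0 vyd.
  by apply: (place_horner_ge0 pv); apply: meets_ge0 vx0.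
(* Induction on the value. If [P] does not vanish at [(c, d)], then [ev P] is a unit; otherwise its
   product with the unit [ev H] is [x - c] times some [ev P'] of smaller value. *)
suff: forall n (P : {poly {poly K}}), ev P != 0 -> v (ev P) < n%:Z ->
    (v (x - iota c) %| v (ev P))%Z.
  by move=> key P P0; apply: (key `|v (ev P)|.+1 P P0); have := ev_ge0 P; lia.
elim=> [|n IH] P P0 vP; first by have := ev_ge0 P; lia.
have /factor_theorem[B BE] : root (P - P.[d%:P]%:P) d%:P by rewrite rootE !hornerE subrr.
set p := P.[d%:P] in BE.
have /factor_theorem[A AE] : root (p - p.[c]%:P) c by rewrite rootE !hornerE subrr.
have PE : ev P = ev B * (y - iota d) + psi A * (x - iota c) + iota p.[c].
  have -> : P = B * ('X - d%:P%:P) + (A * ('X - c%:P))%:P + p.[c]%:P%:P.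
    by rewrite -BE -AE polyCB -addrA subrK subrK.
  by rewrite !(rmorphD, rmorphM, rmorphB, rmorphN) evX !evC psiX !psiC.
have [pc|pc] := eqVneq p.[c] 0; last first.
  have h1 : meets iota v (ev P) p.[c].
    rewrite /meets; case: (eqVneq (ev P) (iota p.[c])) => [|ne]; [by left | right].
    have E1 : ev P - iota p.[c] = ev B * (y - iota d) + psi A * (x - iota c).
      by rewrite PE addrK.
    have E2 : ev H * (ev P - iota p.[c]) = (psi g * ev B + ev H * psi A) * (x - iota c).
      by rewrite E1 mulrDr mulrCA rel; ring.
    have ne' : ev P - iota p.[c] != 0 by rewrite subr_eq0.
    have E3 : psi g * ev B + ev H * psi A = ev (g%:P * B + H * A%:P).
      by rewrite rmorphD !rmorphM !evC.
    have := congr1 v E2; rewrite (placeM pv) // vH add0r => ->.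
    have := ev_ge0 (g%:P * B + H * A%:P); rewrite -E3 => ge0.
    rewrite (placeM pv) //; first by apply: ltr_wpDl.
    apply/eqP => z; move: E2; rewrite z mul0r => /eqP.
    by rewrite mulf_eq0 (negPf H0) (negPf ne').
  by have [_ ->] := meets_neq0 pv h1 pc; rewrite dvdz0.
pose P' := g%:P * B + H * A%:P.
have E : ev H * ev P = ev P' * (x - iota c).
  rewrite PE pc (rmorph0 iota) addr0 /P' rmorphD !rmorphM !evC mulrDr mulrCA rel; ring.
have P'0 : ev P' != 0.
  apply/eqP => z; move: E; rewrite z mul0r => /eqP.
  by rewrite mulf_eq0 (negPf H0) (negPf P0).
have vE : v (ev P) = v (ev P') + v (x - iota c).
  by have := congr1 v E; rewrite (placeM pv) // vH add0r (placeM pv).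
by rewrite vE rpredD ?dvdzz //; apply: IH => //; lia.
Qed.

(** Rationality gives residues of [x] and [y] in [K]. If [f] did not vanish at the residue [c] of
    [x], all values would be multiples of [v (x - c)], which would then be 1, whereas total
    ramification makes it a multiple of [m > 1]. *)
Lemma totally_ramified_root v vinf :
  (1 < m)%N -> m%:R != 0 :> K -> is_place iota vinf -> vinf x < 0 ->
  is_rational_place iota v -> totally_ramified_over iota x m v -> v <> vinf ->
  exists a, root f a /\ 0 < v (x - iota a).
Proof.
move=> m1 m0 pinf vinfx [pv rat] ram ne.
have vx : 0 <= v x.
  rewrite leNgt; apply/negP => vx; apply: ne.
  exact: valued_uniq (valued_inf pv vx) (valued_inf pinf vinfx).
have x0 : x != 0 by rewrite -psiX psi_neq0 // polyX_eq0.
have [c [xE|[xc vxc]]] := rat x x0 vx.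
  by have := psi_neq0 (negbT (polyXsubC_eq0 c)); rewrite psiXsubC xE subrr eqxx.
exists c; split=> //; apply/negPn/negP => fc.
have vx0 : meets iota v x c by right.
have vf : v (psi f) = 0 by apply: (proj2 (meets_neq0 pv (meets_horner pv f vx0) _)).
have vy : v y = 0.
  have := placeX pv m y_neq0; rewrite y_eq vf => /esym/eqP.
  by rewrite mulf_eq0 => /orP[/eqP //|]; lia.
have [d yd] := rat y y_neq0 (eq_ind_r (fun n => 0 <= n) (lexx 0) vy).
have vyd : meets iota v y d by case: yd => [->|[_ ?]]; [left | right].
have dv := unramified pv m0 fc vxc vyd.
have [t [t0 vt]] : exists t, t != 0 /\ v t = 1 by case: pv.
have [P [Q [Q0 tE]]] := generated t.
have P0 : ev P != 0 by apply: contra t0 => /eqP P0; rewrite tE P0 mul0r.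
have d1 : (v (x - iota c) %| 1)%Z.
  have <- : v t = 1%Z by [].
  rewrite tE (placeM pv) ?invr_eq0 // (placeV pv).
  by rewrite rpredB ?dv.
have := ram _ (negbT (polyXsubC_eq0 c)); rewrite -psiE psiXsubC.
move/dvdz_trans/(_ d1); rewrite dvdz1; lia.
Qed.

End Curve.

Arguments psi : simpl never.
Arguments ev : simpl never.

(** * Branches of the curve *)

Lemma classical_min (Q : nat -> Prop) :
  (exists n, Q n) -> exists n, Q n /\ forall k, (k < n)%N -> ~ Q k.
Proof.
case=> n; elim/ltn_ind: n => n IH Qn.
have [[k [kn Qk]]|none] := classic (exists k, (k < n)%N /\ Q k); first exact: IH k kn Qk.
by exists n; split=> // k kn Qk; apply: none; exists k.
Qed.

(** The order along a branch, restricted to [F], need not take the value 1. Its values are the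
    multiples of the least positive one, [g]. *)
Lemma rescale_place (K F : fieldType) (iota : K -> F) (w : F -> int) :
  w 0 = 0 -> (forall c, c != 0 -> w (iota c) = 0) ->
  (forall a b, a != 0 -> b != 0 -> w (a * b) = w a + w b) ->
  (forall a b, a != 0 -> b != 0 -> a + b != 0 -> Num.min (w a) (w b) <= w (a + b)) ->
  (exists t, t != 0 /\ w t != 0) ->
  exists (w' : F -> int) (g : int),
    [/\ is_place iota w', 0 < g & forall z, w z = g * w' z].
Proof.
move=> w0 wC wM wD [t0 [t00 wt0]].
have w1 : w 1 = 0.
  have h := wM 1 1 (oner_neq0 F) (oner_neq0 F); rewrite mulr1 in h.
  by move/eqP: h; rewrite -subr_eq0 opprD addNKr oppr_eq0 => /eqP.
have wV a : a != 0 -> w a^-1 = - w a.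
  by move=> a0; apply/eqP; rewrite -addr_eq0 -wM ?invr_eq0 // mulVf // w1.
have [g [[g0 [t [tn0 wt]]] gmin]] :
    exists n, ((0 < n)%N /\ exists t, t != 0 /\ w t = n%:Z) /\
      forall k, (k < n)%N -> ~ ((0 < k)%N /\ exists t, t != 0 /\ w t = k%:Z).
  apply: classical_min; exists `|w t0|%N; split; first by lia.
  have [h|h] := leP 0 (w t0); first by exists t0; split=> //; lia.
  by exists t0^-1; rewrite invr_eq0 wV //; split=> //; lia.
have dv z : (g%:Z %| w z)%Z.
  have [->|z0] := eqVneq z 0; first by rewrite w0 dvdz0.
  suff: forall n z, z != 0 -> (`|w z| <= n)%N -> (g%:Z %| w z)%Z by move=> /(_ _ z z0); apply.
  elim=> [|n IH] {z0}z z0 wz; first by have -> : w z = 0 by lia.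
  have small : (0 < `|w z| < g)%N -> False.
    move=> /andP[h1 h2]; apply: (gmin _ h2); split=> //.
    have [h|h] := leP 0 (w z); first by exists z; split=> //; lia.
    by exists z^-1; rewrite invr_eq0 wV //; split=> //; lia.
  have [wz0|wz0] := eqVneq (w z) 0; first by rewrite wz0 dvdz0.
  have ti0 : t^-1 != 0 by rewrite invr_eq0.
  have [h|h] := leP 0 (w z).
    have e : w (z * t^-1) = w z - g%:Z by rewrite wM // wV // wt.
    have -> : w z = w (z * t^-1) + g%:Z by rewrite e; lia.
    rewrite rpredD ?dvdzz //; apply: IH; first by rewrite mulf_neq0.
    by rewrite e; case: (ltnP `|w z| g) => hg; [case: small|]; lia.
  have e : w (z * t) = w z + g%:Z by rewrite wM // wt.
  have -> : w z = w (z * t) - g%:Z by rewrite e; lia.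
  rewrite rpredB ?dvdzz //; apply: IH; first by rewrite mulf_neq0.
  by rewrite e; case: (ltnP `|w z| g) => hg; [case: small|]; lia.
pose w' z := (w z %/ g%:Z)%Z; exists w', g%:Z.
have wE z : w z = g%:Z * w' z by rewrite mulrC divzK.
have gn : g%:Z != 0 by lia.
split=> //; split.
- by apply: (mulfI gn); rewrite -wE w0 mulr0.
- by move=> c c0; apply: (mulfI gn); rewrite -wE wC // mulr0.
- by move=> a b a0 b0; apply: (mulfI gn); rewrite mulrDr -!wE wM.
- move=> a b a0 b0 ab0; have := wD a b a0 b0 ab0; rewrite !wE !ge_min.
  by rewrite !ler_pM2l //; lia.
- by exists t; split=> //; apply: (mulfI gn); rewrite -wE wt mulr1.
Qed.

(** * Orders at the origin and roots of power series *)

Section OrderAtZero.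

Variable L : fieldType.

Definition has_order (p : {poly L}) k := exists R, p = 'X^k * R /\ R.[0] != 0.

Lemma has_order_exists p : p != 0 -> exists k, has_order p k.
Proof.
move=> p0; have [k [q + pE]] := multiplicity_XsubC p 0; rewrite p0 /= => q0.
by exists k, q; rewrite pE polyC0 subr0 mulrC.
Qed.

Lemma has_order_dvd p k n : has_order p k -> 'X^n %| p -> (n <= k)%N.
Proof.
move=> [R [-> R0]] dv; rewrite leqNgt; apply/negP => kn.
move: dv; rewrite -(subnKC (ltnW kn)) exprD dvdp_mul2l ?monic_neq0 ?monicXn //.
case: (n - k)%N (subn_gt0 k n) => [|s]; first by rewrite kn.
move=> _ /dvdpP[q RE]; move: R0; rewrite RE exprSr mulrA.
by rewrite hornerM hornerX mulr0 eqxx.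
Qed.

Lemma has_order_dvdn p k : has_order p k -> 'X^k %| p.
Proof. by move=> [R [-> _]]; rewrite dvdp_mulr. Qed.

Lemma has_order_uniq p k l : has_order p k -> has_order p l -> k = l.
Proof.
move=> h h'; apply/eqP; rewrite eqn_leq.
by rewrite (has_order_dvd h' (has_order_dvdn h)) (has_order_dvd h (has_order_dvdn h')).
Qed.

Lemma has_orderM p q k l : has_order p k -> has_order q l -> has_order (p * q) (k + l).
Proof.
move=> [R [-> R0]] [S [-> S0]]; exists (R * S); split; first by rewrite exprD mulrACA.
by rewrite hornerM mulf_neq0.
Qed.

Lemma has_order_congr p q k n : (k < n)%N -> 'X^n %| q - p ->
  has_order p k -> has_order q k.
Proof.
move=> kn /dvdpP[S qE] [R [pE R0]]; exists (R + 'X^(n - k) * S); split.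
  rewrite mulrDr -pE mulrA -exprD subnKC ?(ltnW kn) //.
  by rewrite mulrC -qE addrC subrK.
rewrite hornerD hornerM hornerXn expr0n subn_eq0 leqNgt kn /= mul0r addr0 //.
Qed.

Lemma has_orderX n : has_order 'X^n n.
Proof. by exists 1; rewrite mulr1 hornerE oner_neq0. Qed.

Lemma has_order_unit p : p.[0] != 0 -> has_order p 0.
Proof. by exists p; rewrite expr0 mul1r. Qed.

Lemma has_order_neq0 p k : has_order p k -> p != 0.
Proof.
case=> R [-> R0]; rewrite mulf_neq0 ?(monic_neq0 (monicXn _ _)) //.
by apply: contra R0 => /eqP ->; rewrite horner0.
Qed.

End OrderAtZero.

Section PowerRoot.

Variables (L : fieldType) (m : nat) (G : {poly L}) (b : L).
Hypothesis m0 : m%:R != 0 :> L.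
Hypothesis bG : b ^+ m = G.[0].
Hypothesis b0 : b != 0.

Lemma exprD_order1 (A : comNzRingType) n (a h : A) :
  exists R, (a + h) ^+ n = a ^+ n + a ^+ n.-1 * h *+ n + h ^+ 2 * R.
Proof.
elim: n => [|n [R IH]]; first by exists 0; rewrite !expr0 mulr0n mulr0 !addr0.
exists (a ^+ n.-1 *+ n + (a + h) * R); rewrite exprS IH; case: n {IH} => [|n] /=.
  by rewrite !mulr0n; ring.
by rewrite (exprS a n.+1) (exprS a n); ring.
Qed.

(* Newton approximation of the power series [G ^ (1/m)] with constant term [b]. *)
Fixpoint root_approx n : {poly L} :=
  if n is k.+1 then
    let w := root_approx k in
    w + (- (((w ^+ m - G) %/ 'X^(k.+1)).[0] / (b ^+ m.-1 *+ m)))%:P * 'X^(k.+1)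
  else b%:P.

Lemma root_approx0 n : (root_approx n).[0] = b.
Proof.
elim: n => [|n IH]; first by rewrite hornerC.
by rewrite hornerD IH hornerM hornerXn expr0n mulr0 addr0.
Qed.

Lemma root_approx_step n : 'X^(n.+1) %| root_approx n.+1 - root_approx n.
Proof. by rewrite /= addrC addKr dvdp_mull. Qed.

Lemma root_approxP n : 'X^(n.+1) %| root_approx n ^+ m - G.
Proof.
elim: n => [|n IH].
  by rewrite expr1 -(subr0 'X) -polyC0 dvdp_XsubCl rootE hornerD hornerN
    horner_exp hornerC bG subrr.
rewrite [root_approx n.+1]/=; have w0 := root_approx0 n.
set w := root_approx n in IH w0 *; set q := (w ^+ m - G) %/ 'X^(n.+1).
(* The constant [c] is the Newton correction: it makes [q + m w^(m-1) c] vanish at 0, which gains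
   one power of ['X]. *)
set c := - _; have qE : w ^+ m = G + q * 'X^(n.+1).
  by rewrite divpK // addrC subrK.
have [R ->] := exprD_order1 m w (c%:P * 'X^(n.+1)).
have -> : w ^+ m + w ^+ m.-1 * (c%:P * 'X^(n.+1)) *+ m + (c%:P * 'X^(n.+1)) ^+ 2 * R - G =
    (q + w ^+ m.-1 * c%:P *+ m + c%:P ^+ 2 * R * 'X^n * 'X) * 'X^(n.+1).
  by rewrite qE [in LHS](exprS _ n) [in RHS](exprS _ n); ring.
rewrite [X in X %| _]exprS dvdp_mul2r ?monic_neq0 ?monicXn //.
rewrite -{1}(subr0 'X) -polyC0 dvdp_XsubCl rootE !hornerD hornerMn hornerM horner_exp w0.
rewrite hornerC hornerM hornerX mulr0 addr0 -mulrnAl /c mulrN mulrC divfK ?subrr //.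
by rewrite -mulr_natr mulf_neq0 // expf_neq0.
Qed.

End PowerRoot.

(** * Places of the function field obtained from branches *)

Section Germ.

Variables (K F L : fieldType) (iota : {rmorphism K -> F}) (x y : F).
Variables (m : nat) (f : {poly K}).
Local Notation ev := (ev iota x y).
Local Notation psi := (psi iota x).

Hypothesis norm : forall P : {poly {poly K}}, ev P != 0 ->
  exists (Q : {poly {poly K}}) (N : {poly K}), N != 0 /\ ev P * ev Q = psi N.
Hypothesis ker : forall P : {poly {poly K}}, ev P = 0 ->
  exists Q, P = Q * curve_poly m f.
Hypothesis generated : forall z, exists P Q, ev Q != 0 /\ z = ev P / ev Q.

(* A parametrized branch of the curve: [x] is sent to a polynomial in the local
   parameter ['X], and [y] to the power series approximated by [Y]. *)
Variables (theta : {rmorphism {poly K} -> {poly L}}) (Y : nat -> {poly L}).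
Hypothesis theta_neq0 : forall p : {poly K}, p != 0 -> theta p != 0.
Hypothesis thetaC : forall c : K, c != 0 -> (theta c%:P).[0] != 0.
Hypothesis Y_eq : forall n, 'X^(n.+1) %| Y n ^+ m - theta f.
Hypothesis Y_step : forall n, 'X^(n.+1) %| Y n.+1 - Y n.

(** A representative modulo ['X^(n.+1)] of the power series [P(x(t), y(t))]. *)
Definition germ n : {rmorphism {poly {poly K}} -> {poly L}} :=
  horner_eval (Y n) \o map_poly theta.

Lemma germE n P : germ n P = (map_poly theta P).[Y n].
Proof. by []. Qed.

Lemma germC n p : germ n p%:P = theta p.
Proof. by rewrite germE map_polyC hornerC. Qed.

Lemma germ_step n P : 'X^(n.+1) %| germ n.+1 P - germ n P.
Proof.
elim/poly_ind: P => [|P p IH]; first by rewrite !rmorph0 subrr dvdp0.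
rewrite !germE !horner_map_MXaddC -!germE.
have -> : germ n.+1 P * Y n.+1 + theta p - (germ n P * Y n + theta p) =
    (germ n.+1 P - germ n P) * Y n.+1 + germ n P * (Y n.+1 - Y n) by ring.
by apply: dvdp_add; [apply: dvdp_mulr | apply: dvdp_mull].
Qed.

Lemma germ_coherent n k P : (n <= k)%N -> 'X^(n.+1) %| germ k P - germ n P.
Proof.
move=> /subnKC <-; elim: (k - n)%N => [|s IH]; first by rewrite addn0 subrr dvdp0.
rewrite addnS -(subrKA (germ (n + s) P)) dvdp_add //.
apply: dvdp_trans (germ_step _ _).
by rewrite dvdp_exp2l // ltnS leq_addr.
Qed.

Lemma germ_ker n P : ev P = 0 -> 'X^(n.+1) %| germ n P.
Proof.
move=> /ker[Q ->]; rewrite rmorphM dvdp_mull //.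
rewrite germE /curve_poly rmorphB rmorphXn /= map_polyX map_polyC.
by rewrite hornerD hornerN hornerC hornerXn.
Qed.

Definition ord P k := exists n0, forall n, (n0 <= n)%N -> has_order (germ n P) k.

(** The product of the germs of [P] and of its cofactor [Q] approximates [theta N], whose order [s]
    is finite. So the germ of [P] already shows an order at most [s] at precision [s], and coherence
    preserves it afterwards. *)
Lemma ord_exists P : ev P != 0 -> exists k, ord P k.
Proof.
move=> P0; have [Q [N [N0 PQ]]] := norm P0.
have [s sN] := has_order_exists (theta_neq0 N0).
have dv n : 'X^(n.+1) %| germ n P * germ n Q - theta N.
  rewrite -(germC n) -rmorphM -rmorphB; apply: germ_ker.
  by rewrite rmorphB rmorphM evC PQ subrr.
have ndv : ~~ ('X^(s.+1) %| germ s P).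
  apply/negP => h; have : 'X^(s.+1) %| theta N.
    by rewrite -(dvdp_subr _ (dvdp_mulr (germ s Q) h)).
  by move/(has_order_dvd sN); rewrite ltnn.
have gs0 : germ s P != 0 by apply: contraNneq ndv => ->; rewrite dvdp0.
have [k kP] := has_order_exists gs0.
have ks : (k < s.+1)%N.
  rewrite ltnNge; apply: contra ndv => sk.
  by apply: dvdp_trans (has_order_dvdn kP); rewrite dvdp_exp2l.
by exists k, s => n sn; apply: has_order_congr ks (germ_coherent P sn) kP.
Qed.

Lemma ord_congr P Q k : ev P = ev Q -> ord P k -> ord Q k.
Proof.
move=> PQ [n0 h]; exists (maxn n0 k) => n; rewrite geq_max => /andP[n0n kn].
have kn1 : (k < n.+1)%N by [].
apply: (has_order_congr kn1 _ (h n n0n)); rewrite -rmorphB.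
by apply: germ_ker; rewrite rmorphB PQ subrr.
Qed.

Lemma ord_uniq P k l : ord P k -> ord P l -> k = l.
Proof.
move=> [n h] [n' h']; have a := h (maxn n n') (leq_maxl _ _).
exact: has_order_uniq a (h' (maxn n n') (leq_maxr _ _)).
Qed.

Lemma ordM P Q k l : ord P k -> ord Q l -> ord (P * Q) (k + l).
Proof.
move=> [n h] [n' h']; exists (maxn n n') => s; rewrite geq_max => /andP[sn sn'].
by rewrite rmorphM; apply: has_orderM; [apply: h | apply: h'].
Qed.

Lemma ordD P Q k l s : ord P k -> ord Q l -> ord (P + Q) s -> (minn k l <= s)%N.
Proof.
move=> [n h] [n' h'] [n'' h'']; pose N := maxn n (maxn n' n'').
have hN := h N (leq_maxl _ _).
have hN' : has_order (germ N Q) l by apply: h'; rewrite /N; lia.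
have hN'' : has_order (germ N (P + Q)) s by apply: h''; rewrite /N; lia.
apply: (has_order_dvd hN''); rewrite rmorphD dvdp_add //.
  by apply: dvdp_trans (has_order_dvdn hN); rewrite dvdp_exp2l // geq_minl.
by apply: dvdp_trans (has_order_dvdn hN'); rewrite dvdp_exp2l // geq_minr.
Qed.

Lemma ord_neq0 P k : ord P k -> ev P != 0.
Proof.
move=> [n h]; apply/eqP => /germ_ker dv.
have := has_order_dvd (h (maxn n k) (leq_maxl _ _)) (dv _).
by rewrite ltnNge leq_maxr.
Qed.

Lemma ordC p k : has_order (theta p) k -> ord p%:P k.
Proof. by move=> h; exists 0%N => n _; rewrite germC. Qed.

Lemma ord_dvd P k s n : ord P k -> (s <= k)%N -> (s <= n.+1)%N -> 'X^s %| germ n P.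
Proof.
move=> [n0 h] sk sn.
have dv : 'X^s %| germ (maxn n0 n) P.
  apply: dvdp_trans (has_order_dvdn (h _ (leq_maxl _ _))).
  by rewrite dvdp_exp2l.
rewrite -(dvdp_subr _ dv); apply: dvdp_trans (germ_coherent P (leq_maxr n0 n)).
by rewrite dvdp_exp2l.
Qed.

Definition is_val (z : F) (n : int) := exists P Q k l,
  [/\ ord P k, ord Q l, z = ev P / ev Q & n = k%:Z - l%:Z].

Lemma is_val_exists z : z != 0 -> exists n, is_val z n.
Proof.
move=> z0; have [P [Q [Q0 zE]]] := generated z.
have P0 : ev P != 0 by apply: contra z0 => /eqP P0; rewrite zE P0 mul0r.
have [k hk] := ord_exists P0; have [l hl] := ord_exists Q0.
by exists (k%:Z - l%:Z), P, Q, k, l.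
Qed.

Lemma is_val_uniq z n n' : is_val z n -> is_val z n' -> n = n'.
Proof.
move=> [P [Q [k [l [hP hQ zE ->]]]]] [P' [Q' [k' [l' [hP' hQ' zE' ->]]]]].
have E : ev (P * Q') = ev (P' * Q).
  rewrite !rmorphM; apply/eqP; rewrite -eqr_div ?(ord_neq0 hQ) ?(ord_neq0 hQ') //.
  by rewrite -zE -zE'.
have := ord_uniq (ord_congr E (ordM hP hQ')) (ordM hP' hQ); lia.
Qed.

Lemma is_valM a b n n' : is_val a n -> is_val b n' -> is_val (a * b) (n + n').
Proof.
move=> [P [Q [k [l [hP hQ -> ->]]]]] [P' [Q' [k' [l' [hP' hQ' -> ->]]]]].
exists (P * P'), (Q * Q'), (k + k')%N, (l + l')%N; split; [exact: ordM | exact: ordM | |lia].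
by rewrite !rmorphM invfM mulrACA.
Qed.

Lemma is_valD a b n n' s : is_val a n -> is_val b n' -> is_val (a + b) s ->
  Num.min n n' <= s.
Proof.
move=> [P [Q [k [l [hP hQ aE ->]]]]] [P' [Q' [k' [l' [hP' hQ' bE ->]]]]] hs.
have Q0 := ord_neq0 hQ; have Q'0 := ord_neq0 hQ'.
have sE : (a + b) = ev (P * Q' + P' * Q) / ev (Q * Q').
  by rewrite aE bE rmorphD !rmorphM addf_div.
have ab0 : ev (P * Q' + P' * Q) != 0.
  move: hs => [P1 [Q1 [k1 [l1 [hP1 hQ1 abE _]]]]].
  have : a + b != 0 by rewrite abE mulf_neq0 ?invr_eq0 ?(ord_neq0 hP1) ?(ord_neq0 hQ1).
  by apply: contra => /eqP z; rewrite sE z mul0r.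
have [t ht] := ord_exists ab0.
have hs' : is_val (a + b) (t%:Z - (l + l')%:Z).
  by exists (P * Q' + P' * Q), (Q * Q'), t, (l + l')%N; split=> //; apply: ordM.
rewrite (is_val_uniq hs hs') ge_min.
have := ordD (ordM hP hQ') (ordM hP' hQ) ht; lia.
Qed.

(** The branch has coefficients in [L], but its order is only evaluated on [F], where it is trivial
    on [K]. The polynomial [P0] witnesses that it is not identically zero. *)
Lemma germ_place (P0 : {poly {poly K}}) k0 : ord P0 k0 -> (0 < k0)%N ->
  exists (w : F -> int) (g : int), [/\ is_place iota w, 0 < g &
    forall P k, ord P k -> k%:Z = g * w (ev P)].
Proof.
move=> hP0 k00.
pose w z := if z == 0 then 0 else epsilon (inhabits 0) (is_val z).
have wP z : z != 0 -> is_val z (w z).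
  by move=> z0; rewrite /w (negPf z0); apply: epsilon_spec; apply: is_val_exists.
have one_ord c : c != 0 -> ord c%:P%:P 0.
  by move=> c0; apply/ordC/has_order_unit/thetaC.
have w_ord P k : ord P k -> w (ev P) = k%:Z.
  move=> hP; apply: (is_val_uniq (wP _ (ord_neq0 hP))).
  exists P, 1%:P%:P, k, 0%N; split=> //; first by apply/one_ord/oner_neq0.
    by rewrite evC psiC rmorph1 divr1.
  by rewrite subr0.
have [] := @rescale_place K F iota w.
- by rewrite /w eqxx.
- by move=> c /one_ord /w_ord; rewrite evC psiC.
- move=> a b a0 b0; apply: (is_val_uniq (wP _ _)); first by rewrite mulf_neq0.
  by apply: is_valM; apply: wP.
- by move=> a b a0 b0 ab0; apply: is_valD (wP _ a0) (wP _ b0) (wP _ ab0).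
- exists (ev P0); rewrite (ord_neq0 hP0) (w_ord _ _ hP0); split=> //; lia.
move=> w' [g [pw g0 wE]]; exists w', g; split=> // P k hP.
by rewrite -wE (w_ord _ _ hP).
Qed.

End Germ.

(** * From regularity of a function to regularity of its terms *)

Lemma mup_map (K L : fieldType) (j : {rmorphism K -> L}) c (p : {poly K}) :
  p != 0 -> mup (j c) (map_poly j p) = mup c p.
Proof.
move=> p0; have [k [q + pE]] := multiplicity_XsubC p c; rewrite p0 /= => qc.
rewrite {2}pE mupMr // mup_XsubCX eqxx pE rmorphM rmorphXn rmorphB /= map_polyX map_polyC.
by rewrite mupMr ?mup_XsubCX ?eqxx // fmorph_root.
Qed.

Lemma size_le_mup (L : closedFieldType) (p q : {poly L}) :
  p != 0 -> q != 0 -> (forall a, (mup a p <= mup a q)%N) -> (size p <= size q)%N.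
Proof.
move=> p0 q0 le; have [n] := ubnP (size p).
elim: n p q p0 q0 le => // n IH p q p0 q0 le; rewrite ltnS => sp.
have [s1|s1] := leqP (size p) 1; first by rewrite (leq_trans s1) // size_poly_gt0.
have /closed_rootP[a pa] : size p != 1%N by rewrite neq_ltn s1 orbT.
have : (0 < mup a p)%N by rewrite -XsubC_dvd // dvdp_XsubCl.
move=> /leq_trans /(_ (le a)); rewrite -XsubC_dvd // dvdp_XsubCl => /factor_theorem[q' qE].
have [p' pE] := factor_theorem _ _ pa.
have p'0 : p' != 0 by apply: contra p0 => /eqP z; rewrite pE z mul0r.
have q'0 : q' != 0 by apply: contra q0 => /eqP z; rewrite qE z mul0r.
have X0 : 'X - a%:P != 0 by rewrite polyXsubC_eq0.
rewrite pE qE !size_Mmonic ?monicXsubC // !size_XsubC !addn2 /= ltnS.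
apply: IH => //; last by move: sp; rewrite pE size_Mmonic ?monicXsubC // size_XsubC addn2.
by move=> c; have := le c; rewrite pE qE !mupM // leq_add2r.
Qed.

Section UnityRoots.

Variables (L : closedFieldType) (m : nat).
Hypothesis m0 : m%:R != 0 :> L.

Lemma unity_roots : exists rs : seq L,
  [/\ uniq rs, size rs = m & forall z, z \in rs -> z ^+ m = 1].
Proof.
have m_gt0 : (0 < m)%N by rewrite lt0n; apply: contraNneq m0 => ->.
have [rs] := closed_field_poly_normal ('X^m - 1 : {poly L}).
have mon : ('X^m - 1 : {poly L}) \is monic by rewrite -polyC1 monicXnsubC.
rewrite (monicP mon) scale1r => E.
exists rs; split.
- by rewrite -separable_prod_XsubC -E separable_Xn_sub_1.
- have := size_prod_XsubC rs id; rewrite -E => sz.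
  by have := size_XnsubC (1 : L) m_gt0; rewrite polyC1 sz => -[].
- move=> z zr; have : root ('X^m - 1) z by rewrite E root_prod_XsubC.
  by rewrite rootE hornerD hornerN hornerXn hornerC subr_eq0 => /eqP.
Qed.

(* Vandermonde: the sums over all m-th roots of unity determine each term. *)
Lemma dvd_terms_of_twists (c : nat -> {poly L}) N :
  (forall z, z ^+ m = 1 -> 'X^N %| \sum_(i < m) c i * (z ^+ i)%:P) ->
  forall i, (i < m)%N -> 'X^N %| c i.
Proof.
have coef_dvd (p : {poly L}) : 'X^N %| p <-> forall k, (k < N)%N -> p`_k = 0.
  split=> [/dvdpP[q ->] k kN|h]; first by rewrite coefMXn kN.
  apply/dvdpP; exists (drop_poly N p); rewrite -[LHS](poly_take_drop N).
  suff -> : take_poly N p = 0 by rewrite add0r.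
  by apply/polyP => k; rewrite coef_take_poly coef0; case: ifP => // /h.
move=> H i im; apply/coef_dvd => k kN.
have [rs [urs srs rsP]] := unity_roots.
pose q := \poly_(i < m) (c i)`_k.
have q0 : q = 0.
  apply/eqP/negPn/negP => q0.
  have : (size rs < size q)%N.
    apply: max_poly_roots q0 _ urs; apply/allP => z /rsP zm.
    have /coef_dvd/(_ k kN) := H z zm; rewrite coef_sum => E.
    rewrite rootE horner_poly -[X in _ == X]E; apply/eqP/eq_bigr => l _.
    by rewrite coefMC.
  by rewrite srs ltnNge size_poly.
by have := coef_poly m (fun i => (c i)`_k) i; rewrite -/q q0 coef0 im.
Qed.

End UnityRoots.

Section LocalForm.

Variables (K : fieldType) (L : closedFieldType) (j : {rmorphism K -> L}).
Variables (m : nat) (f : {poly K}).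
Hypothesis m0 : m%:R != 0 :> K.
Hypothesis f_sep : separable_poly f.

Definition shift_at (a : L) e : {rmorphism {poly K} -> {poly L}} :=
  comp_poly (a%:P + 'X^e) \o map_poly j.

Lemma shift_atE a e p : shift_at a e p = map_poly j p \Po (a%:P + 'X^e).
Proof. by []. Qed.

Lemma horner0_comp_shift a e (p : {poly L}) : (0 < e)%N ->
  (p \Po (a%:P + 'X^e)).[0] = p.[a].
Proof.
by move=> e0; rewrite horner_comp hornerD hornerC hornerXn expr0n gtn_eqF // addr0.
Qed.

Lemma shift_at_order a e (p : {poly K}) : (0 < e)%N -> p != 0 ->
  has_order (shift_at a e p) (e * mup a (map_poly j p)).
Proof.
move=> e0 p0; have jp0 : map_poly j p != 0 by rewrite map_poly_eq0.
have [k [q + pE]] := multiplicity_XsubC (map_poly j p) a; rewrite jp0 implyTb => qa.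
have -> : mup a (map_poly j p) = k by rewrite pE mupMr // mup_XsubCX eqxx.
rewrite shift_atE pE rmorphM rmorphXn /= comp_polyB comp_polyX comp_polyC.
exists (q \Po (a%:P + 'X^e)); split; last by rewrite horner0_comp_shift.
by rewrite addrAC subrr add0r mulrC exprM.
Qed.

(* The branches above [x = a] are [x = a + t^e], [y = t^d w] with [w^m = G]:
   [(e, d)] is [(1, 0)] when [f.[a] != 0] and [(m, 1)] when [f.[a] = 0]. *)
Lemma local_form (a : L) : exists e d (G : {poly L}),
  [/\ (0 < e)%N, forall i, (i < m)%N -> (d * i < e)%N,
      shift_at a e f = 'X^(d * m) * G & G.[0] != 0].
Proof.
have m_gt0 : (0 < m)%N by rewrite lt0n; apply: contraNneq m0 => ->.
have [fa|fa] := boolP (root (map_poly j f) a); last first.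
  exists 1%N, 0%N, (shift_at a 1 f); split=> //; first by rewrite mul0n expr0 mul1r.
  by rewrite shift_atE horner0_comp_shift.
have [g gE] := factor_theorem _ _ fa.
exists m, 1%N, (g \Po (a%:P + 'X^m)); split=> //; first by move=> i; rewrite mul1n.
  by rewrite shift_atE gE rmorphM /= comp_polyB comp_polyX comp_polyC addrAC subrr add0r mul1n mulrC.
rewrite horner0_comp_shift //.
have : separable_poly (map_poly j f) by rewrite separable_map.
by rewrite gE separable_root => /andP[].
Qed.

End LocalForm.

Section Regularity.

Variables (K F : fieldType) (L : closedFieldType).
Variables (iota : {rmorphism K -> F}) (j : {rmorphism K -> L}) (x y : F).
Variables (m : nat) (f : {poly K}).
Local Notation ev := (ev iota x y).
Local Notation psi := (psi iota x).
Hypothesis m0 : m%:R != 0 :> K.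
Hypothesis f_sep : separable_poly f.
Hypothesis psi_neq0 : forall p : {poly K}, p != 0 -> psi p != 0.
Hypothesis norm : forall P : {poly {poly K}}, ev P != 0 ->
  exists (Q : {poly {poly K}}) (N : {poly K}), N != 0 /\ ev P * ev Q = psi N.
Hypothesis ker : forall P : {poly {poly K}}, ev P = 0 ->
  exists Q, P = Q * curve_poly m f.
Hypothesis generated : forall z, exists P Q, ev Q != 0 /\ z = ev P / ev Q.

(** The condition on [w] says that it lies above [x = a], even when [a] is not in the image of [K].
    If [D] vanishes at [a], each [m]-th root of unity [z] yields such a place, from the branch with
    [y] multiplied by [z], and [A] vanishes there at least as much as [D]. Inverting the twists
    transfers this to every term. *)
Lemma mup_regular (A : {poly {poly K}}) (D : {poly K}) (a : L) :
  (size A <= m)%N -> D != 0 -> ev A != 0 ->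
  (forall w, is_place iota w -> 0 <= w x ->
     (forall c, a != j c -> w (x - iota c) = 0) -> 0 <= w (ev A / psi D)) ->
  forall i, A`_i != 0 -> (mup a (map_poly j D) <= mup a (map_poly j A`_i))%N.
Proof.
move=> Am D0 A0 reg i Ai.
have [->//|s0] := posnP (mup a (map_poly j D)).
have mL : m%:R != 0 :> L by rewrite -(rmorph_nat j) fmorph_eq0.
have [e [d [G [e0 de fE G0]]]] := local_form j m0 f_sep a.
have [b bG] : exists b, b ^+ m = G.[0].
  have m_gt0 : (0 < m)%N by rewrite lt0n; apply: contraNneq m0 => ->.
  have /closed_rootP[b] : size ('X^m - G.[0]%:P) != 1%N.
    by rewrite size_XnsubC //; case: (m) m_gt0.
  by rewrite rootE hornerD hornerN hornerXn hornerC subr_eq0 => /eqP; exists b.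
have m_gt0 : (0 < m)%N by rewrite lt0n; apply: contraNneq m0 => ->.
have b0 : b != 0.
  by apply: contraNneq G0 => bz; rewrite -bG bz expr0n gtn_eqF.
pose N := (e * mup a (map_poly j D))%N.
pose W := root_approx m G b N.
have im : (i < m)%N.
  by apply: leq_trans Am; rewrite ltnNge; apply: contra Ai => /(nth_default 0) ->.
have key : 'X^N %| shift_at j a e A`_i * ('X^d * W) ^+ i.
  pose c k := shift_at j a e A`_k * ('X^d * W) ^+ k.
  apply: (dvd_terms_of_twists mL (c := c)) => // z zm.
  pose Y n := z%:P * ('X^d * root_approx m G b n).
  have z_unit : z != 0.
    by apply/eqP => zz; move: zm; rewrite zz expr0n gtn_eqF // => /esym/eqP; rewrite oner_eq0.
  have th0 p : p != 0 -> shift_at j a e p != 0.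
    by move=> p0; apply: has_order_neq0 (shift_at_order j a e0 p0).
  have thC (k : K) : k != 0 -> (shift_at j a e k%:P).[0] != 0.
    by move=> k0; rewrite shift_atE map_polyC comp_polyC hornerC fmorph_eq0.
  have Yeq n : 'X^(n.+1) %| Y n ^+ m - shift_at j a e f.
    rewrite fE /Y !exprMn -polyC_exp zm polyC1 mul1r -exprM -mulrBr.
    by rewrite dvdp_mull // root_approxP.
  have Ystep n : 'X^(n.+1) %| Y n.+1 - Y n.
    by rewrite /Y -!mulrBr !dvdp_mull // root_approx_step.
  have oD := ordC Y (shift_at_order j a e0 D0).
  have N0 : (0 < e * mup a (map_poly j D))%N by rewrite muln_gt0 e0.
  have [w [g [pw g0 wE]]] := germ_place norm ker generated th0 thC Yeq Ystep oD N0.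
  have [k kA] := ord_exists norm ker th0 Yeq Ystep A0.
  have wx : 0 <= w x.
    have X0 : ('X : {poly K}) != 0 by rewrite polyX_eq0.
    have := wE _ _ (ordC Y (shift_at_order j a e0 X0)); rewrite evC psiX => h.
    by rewrite -(pmulr_rge0 _ g0) -h.
  have wc (q : K) : a != j q -> w (x - iota q) = 0.
    move=> aq; have X0 : ('X - q%:P) != 0 by rewrite polyXsubC_eq0.
    have := wE _ _ (ordC Y (shift_at_order j a e0 X0)); rewrite evC psiXsubC.
    rewrite rmorphB /= map_polyX map_polyC -['X - _]expr1 mup_XsubCX eq_sym (negPf aq) muln0.
    by move=> /esym/eqP; rewrite mulf_eq0 (gt_eqF g0) => /eqP.
  have := reg w pw wx wc; rewrite (placeM pw) ?invr_eq0 ?psi_neq0 // (placeV pw).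
  have hA := wE _ _ kA; have hD := wE _ _ oD; rewrite evC in hD.
  rewrite subr_ge0 -(ler_pM2l g0) -hA -hD lez_nat => Nk.
  have := ord_dvd Ystep (n := N) kA Nk (leqnSn _).
  rewrite germE (@horner_coef_wide _ m); last by rewrite (leq_trans (size_poly _ _)).
  congr (_ %| _); apply: eq_bigr => l _; rewrite coef_map /c /Y exprMn -polyC_exp -/W.
  by rewrite mulrCA mulrC.
have W0 : has_order (W ^+ i) 0.
  by apply: has_order_unit; rewrite horner_exp root_approx0 expf_neq0.
have oi := has_orderM (shift_at_order j a e0 Ai) (has_orderM (has_orderX L (d * i)) W0).
move: key; rewrite exprMn -exprM => /(has_order_dvd oi).
(* The power of [y] adds only [d * i < e] to [e] times the multiplicity of [A_i], too little to make
   up for a missing root. *)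
rewrite /N addn0 => h; have := de i im; nia.
Qed.

End Regularity.

(** * The two-point semigroups *)

Lemma inH2C (K F : fieldType) (iota : K -> F) v1 v2 n1 n2 :
  inH2 iota v1 v2 (n1, n2) -> inH2 iota v2 v1 (n2, n1).
Proof. by case=> z [h1 h2 h]; exists z; split=> // w pw w2 w1; apply: h. Qed.

Lemma div_nonneg (m i : nat) (k : int) :
  (i < m)%N -> 0 <= m%:Z * k + i%:Z -> 0 <= k.
Proof.
move=> im h; rewrite leNgt; apply/negP => k0.
have : m%:Z * k <= m%:Z * -1 by rewrite ler_pM2l; lia.
lia.
Qed.

Lemma subz_of_leq (d e c1 c2 c3 c4 : nat) : (0 < d)%N -> (0 < e)%N ->
  (d + c3 + c4 <= e + c1 + c2)%N ->
  (c3%:Z - c1%:Z) + (c4%:Z - c2%:Z) <= - d.-1%:Z - - e.-1%:Z.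
Proof. lia. Qed.

Section MulXsubC2.

Variables (L : fieldType) (b c : L) (n k : nat) (p : {poly L}).
Hypothesis p0 : p != 0.

Let X0 (z : L) l : ('X - z%:P) ^+ l != 0.
Proof. by rewrite expf_neq0 // polyXsubC_eq0. Qed.

Lemma mul_XsubC2_neq0 : p * (('X - b%:P) ^+ n * ('X - c%:P) ^+ k) != 0.
Proof. by rewrite !mulf_neq0. Qed.

Lemma size_mul_XsubC2 :
  size (p * (('X - b%:P) ^+ n * ('X - c%:P) ^+ k)) = (size p + n + k)%N.
Proof.
have mX (z : L) l : ('X - z%:P) ^+ l \is monic by rewrite rpredX ?monicXsubC.
have mM : ('X - b%:P) ^+ n * ('X - c%:P) ^+ k \is monic by rewrite monicMl ?mX.
rewrite (size_Mmonic p0 mM) (size_Mmonic (X0 _ _) (mX _ _)) !size_exp_XsubC.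
by rewrite addnS /= addSn addnS /= addnA.
Qed.

Lemma mup_mul_XsubC2 a : mup a (p * (('X - b%:P) ^+ n * ('X - c%:P) ^+ k)) =
  (mup a p + (if b == a then n else 0) + (if c == a then k else 0))%N.
Proof. by rewrite mupM ?mulf_neq0 // mupM // !mup_XsubCX addnA. Qed.

End MulXsubC2.

(** * Necessary and sufficient conditions on the exponents *)

Section KummerCurve.

Variables (K F : fieldType) (L : closedFieldType).
Variables (iota : {rmorphism K -> F}) (j : {rmorphism K -> L}) (x y : F).
Local Notation ev := (ev iota x y).
Local Notation psi := (psi iota x).
Variables (m r : nat) (f : {poly K}).
Hypothesis m_gt0 : (0 < m)%N.
Hypothesis m_neq0 : m%:R != 0 :> K.
Hypothesis f_sep : separable_poly f.
Hypothesis f_size : size f = r.+1.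
Hypothesis co_mr : coprime m r.
Hypothesis psi_neq0 : forall p : {poly K}, p != 0 -> psi p != 0.
Hypothesis y_eq : y ^+ m = psi f.
Hypothesis generated : forall z, exists P Q, ev Q != 0 /\ z = ev P / ev Q.
Variable vinf : F -> int.
Hypothesis pinf : is_place iota vinf.
Hypothesis vinf_x : vinf x < 0.

Let infV : valued iota x y m vinf (@kappa_inf K) (- r%:Z).
Proof. exact: (valued_inf m_gt0 f_sep f_size co_mr psi_neq0 y_eq generated). Qed.

Let y0 : y != 0.
Proof. exact: (y_neq0 m_gt0 f_size psi_neq0 y_eq). Qed.

Let xc0 c : x - iota c != 0.
Proof. by rewrite -psiXsubC psi_neq0 // polyXsubC_eq0. Qed.

Section TwoRoots.

Variables (a1 a2 : K) (v1 v2 : F -> int).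
Hypothesis a12 : a1 != a2.
Hypothesis fa1 : root f a1.
Hypothesis fa2 : root f a2.
Hypothesis p1 : is_place iota v1.
Hypothesis p2 : is_place iota v2.
Hypothesis v1_a1 : 0 < v1 (x - iota a1).
Hypothesis v2_a2 : 0 < v2 (x - iota a2).

Let V1 : valued iota x y m v1 (kappa_at a1) 1.
Proof. exact: (valued_root m_gt0 f_sep f_size co_mr psi_neq0 y_eq generated). Qed.

Let V2 : valued iota x y m v2 (kappa_at a2) 1.
Proof. exact: (valued_root m_gt0 f_sep f_size co_mr psi_neq0 y_eq generated). Qed.

(** Cross-multiplying [D] and [A_i] by powers of the two linear factors equalises the multiplicities
    at [a1] and [a2]. At every other point [D] has the smaller one by [mup_regular], and over a
    closed field this compares degrees. *)
Lemma degree_bound (A : {poly {poly K}}) (D : {poly K}) :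
  A != 0 -> (size A <= m)%N -> D != 0 ->
  (forall w, is_place iota w -> w <> vinf -> w <> v1 -> w <> v2 ->
     0 <= w (ev A / psi D)) ->
  forall i, A`_i != 0 ->
    (kappa_at a1 A`_i - kappa_at a1 D) + (kappa_at a2 A`_i - kappa_at a2 D)
    <= kappa_inf D - kappa_inf A`_i.
Proof.
move=> A0 Am D0 reg i Ai.
have evA : ev A != 0.
  have [+ _ _] := valued_min m_gt0 f_sep f_size co_mr psi_neq0 y_eq infV A0 Am D0.
  by apply: contra => /eqP ->; rewrite mul0r.
have jD0 : map_poly j D != 0 by rewrite map_poly_eq0.
have jA0 : map_poly j A`_i != 0 by rewrite map_poly_eq0.
have le a : a != j a1 -> a != j a2 ->
    (mup a (map_poly j D) <= mup a (map_poly j A`_i))%N.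
  move=> n1 n2.
  have norm P := @ev_norm _ _ iota x y m f m_gt0 y_eq P.
  have ker P := @ev_eq0 _ _ _ _ _ _ _ _ m_gt0 f_sep f_size co_mr psi_neq0 y_eq _ _ _ P infV.
  apply: (mup_regular m_neq0 f_sep psi_neq0 norm ker generated Am D0 evA _ Ai).
  move=> w pw wx wc; apply: reg => // E.
  - by move: wx; rewrite E leNgt vinf_x.
  - by move: v1_a1; rewrite -E wc.
  - by move: v2_a2; rewrite -E wc.
have j12 : (j a1 == j a2) = false.
  by apply/negbTE; apply: contra a12 => /eqP/fmorph_inj ->.
have h : (size (map_poly j D) + mup a1 A`_i + mup a2 A`_i <=
    size (map_poly j A`_i) + mup a1 D + mup a2 D)%N.
  rewrite -(size_mul_XsubC2 (j a1) (j a2) _ _ jD0) -(size_mul_XsubC2 (j a1) (j a2) _ _ jA0).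
  apply: size_le_mup; try exact: mul_XsubC2_neq0.
  move=> a; rewrite !mup_mul_XsubC2 //.
  have [<-|n1] := eqVneq (j a1) a.
    by rewrite eq_sym j12 !mup_map // !addn0 addnC.
  have [<-|n2] := eqVneq (j a2) a; first by rewrite !mup_map // !addn0 addnC.
  by rewrite !addn0 le // eq_sym.
have sD : (0 < size D)%N by rewrite size_poly_gt0.
have sA : (0 < size (A`_i)%R)%N by rewrite size_poly_gt0.
move: h; rewrite !size_map_poly /kappa_inf /kappa_at.
exact: subz_of_leq.
Qed.

Definition monomial (k1 k2 : int) i := (x - iota a1) ^ k1 * (x - iota a2) ^ k2 * y ^+ i.

Let mono0 k1 k2 i : monomial k1 k2 i != 0.
Proof. by rewrite /monomial !mulf_neq0 ?expf_neq0 // expfz_neq0. Qed.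

Lemma place_monomial w k1 k2 i : is_place iota w ->
  w (monomial k1 k2 i) = w (x - iota a1) * k1 + w (x - iota a2) * k2 + w y * i%:Z.
Proof.
move=> pw; rewrite /monomial !(placeM pw) ?mulf_neq0 ?expf_neq0 ?expfz_neq0 //.
by rewrite !(placeXz pw) // (placeX pw).
Qed.

Lemma kappa_at_XsubC (a c : K) : kappa_at a ('X - c%:P) = (c == a)%:Z.
Proof. by rewrite /kappa_at -['X - _]expr1 mup_XsubCX; case: eqP. Qed.

Lemma v1_monomial k1 k2 i : v1 (monomial k1 k2 i) = m%:Z * k1 + i%:Z.
Proof.
rewrite place_monomial // -!psiXsubC !(valued_psi V1) ?polyXsubC_eq0 //.
by rewrite !kappa_at_XsubC (valued_y V1) eqxx eq_sym (negPf a12); lia.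
Qed.

Lemma v2_monomial k1 k2 i : v2 (monomial k1 k2 i) = m%:Z * k2 + i%:Z.
Proof.
rewrite place_monomial // -!psiXsubC !(valued_psi V2) ?polyXsubC_eq0 //.
by rewrite !kappa_at_XsubC (valued_y V2) eqxx (negPf a12); lia.
Qed.

Lemma vinf_monomial k1 k2 i :
  vinf (monomial k1 k2 i) = - (m%:Z * (k1 + k2) + r%:Z * i%:Z).
Proof.
rewrite place_monomial // -!psiXsubC !(valued_psi infV) ?polyXsubC_eq0 //.
by rewrite /kappa_inf !size_XsubC (valued_y infV); lia.
Qed.

(** Uniqueness identifies a pole of [x] with [vinf] and a zero of [x - a1] or [x - a2] with [v1] or
    [v2]; at any other place both factors are units and [y] is integral. *)
Lemma monomial_regular w k1 k2 i : is_place iota w ->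
  w <> vinf -> w <> v1 -> w <> v2 -> 0 <= w (monomial k1 k2 i).
Proof.
move=> pw ninf n1 n2.
have uniq v kappa d := @valued_uniq _ _ _ _ _ _ _ _
  m_gt0 f_sep f_size co_mr psi_neq0 y_eq generated w v kappa d.
have wx : 0 <= w x.
  rewrite leNgt; apply/negP => wx; apply: ninf; apply: uniq infV.
  exact: (valued_inf m_gt0 f_sep f_size co_mr psi_neq0 y_eq generated).
have wc c : 0 <= w (x - iota c).
  apply: (placeD_ge pw) => //; rewrite (placeN pw); exact: placeC_ge0.
have z1 : w (x - iota a1) = 0.
  apply/eqP; rewrite eq_le wc andbT leNgt; apply/negP => h; apply: n1; apply: uniq V1.
  exact: (valued_root m_gt0 f_sep f_size co_mr psi_neq0 y_eq generated).
have z2 : w (x - iota a2) = 0.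
  apply/eqP; rewrite eq_le wc andbT leNgt; apply/negP => h; apply: n2; apply: uniq V2.
  exact: (valued_root m_gt0 f_sep f_size co_mr psi_neq0 y_eq generated).
have wy : 0 <= w y.
  have : 0 <= w (psi f) by apply: place_horner_ge0.
  by rewrite -y_eq (placeX pw) // pmulr_lge0 // ltz_nat.
by rewrite place_monomial // z1 z2 !mul0r !add0r mulr_ge0.
Qed.

Let ne1 : v1 <> vinf.
Proof.
move=> E; have := v1_a1; rewrite E -psiXsubC (valued_psi infV) ?polyXsubC_eq0 //.
by rewrite /kappa_inf size_XsubC; lia.
Qed.

Let ne2 : v2 <> vinf.
Proof.
move=> E; have := v2_a2; rewrite E -psiXsubC (valued_psi infV) ?polyXsubC_eq0 //.
by rewrite /kappa_inf size_XsubC; lia.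
Qed.

Let ne21 : v2 <> v1.
Proof.
move=> E; have := v2_a2; rewrite E -psiXsubC (valued_psi V1) ?polyXsubC_eq0 //.
by rewrite kappa_at_XsubC eq_sym (negPf a12) mulr0.
Qed.

(** The index [i] is that of the term attaining the value of [z] at the first place; at the other
    places this term is no worse than [z]. By [degree_bound] its coefficient may be replaced by
    powers of the two linear factors. *)
Lemma ram_necessary n1 n2 : inH2 iota v1 v2 (n1, n2) -> ram_cond m r n1 n2.
Proof.
case=> z [/= h1 h2 hz] n10.
have [A [D [Am D0 zE]]] := normal_form m_gt0 psi_neq0 y_eq generated z.
have vz1 : v1 z = - n1%:Z by apply/polecoefE.
have vz2 := polecoef_ge h2.
have A0 : A != 0.
  by apply/eqP => A0; move: vz1; rewrite zE A0 rmorph0 mul0r (place0 p1); lia.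
have [_ [i [im Ai e1]] _] := valued_min m_gt0 f_sep f_size co_mr psi_neq0 y_eq V1 A0 Am D0.
have [_ _ l2] := valued_min m_gt0 f_sep f_size co_mr psi_neq0 y_eq V2 A0 Am D0.
have [_ _ l0] := valued_min m_gt0 f_sep f_size co_mr psi_neq0 y_eq infV A0 Am D0.
have zinf : 0 <= vinf z by apply/polecoef_eq0/hz => // /esym.
have db := degree_bound A0 Am D0 _ Ai.
have reg w : is_place iota w -> w <> vinf -> w <> v1 -> w <> v2 -> 0 <= w (ev A / psi D).
  by move=> pw _ w1 w2; rewrite -zE; apply/polecoef_eq0/hz.
exists i, (kappa_at a1 A`_i - kappa_at a1 D), (kappa_at a2 A`_i - kappa_at a2 D).
have := db reg; have := l2 i Ai; have := l0 i Ai; rewrite -zE in e1 *.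
rewrite !mul1r in e1 *; move: (kappa_at a1 _ - _) (kappa_at a2 _ - _) e1 => k1 k2 e1.
rewrite -[kappa_inf A`_i - _]opprB; move: (kappa_inf D - _) => k0 b0 b2 b3.
split=> //; first by rewrite -vz1.
  exact: le_trans vz2 b2.
have : m%:Z * (k1 + k2) <= m%:Z * k0 by rewrite ler_pM2l.
clear - b0 zinf; lia.
Qed.

Lemma inf_necessary1 n0 n1 : inH2 iota vinf v1 (n0, n1) -> inf_cond1 m r n0 n1.
Proof.
case=> z [/= h0 h1 hz] n10.
have [A [D [Am D0 zE]]] := normal_form m_gt0 psi_neq0 y_eq generated z.
have vz1 : v1 z = - n1%:Z by apply/polecoefE.
have vz0 := polecoef_ge h0.
have A0 : A != 0.
  by apply/eqP => A0; move: vz1; rewrite zE A0 rmorph0 mul0r (place0 p1); lia.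
have [_ [i [im Ai e1]] _] := valued_min m_gt0 f_sep f_size co_mr psi_neq0 y_eq V1 A0 Am D0.
have [_ _ l2] := valued_min m_gt0 f_sep f_size co_mr psi_neq0 y_eq V2 A0 Am D0.
have [_ _ l0] := valued_min m_gt0 f_sep f_size co_mr psi_neq0 y_eq infV A0 Am D0.
have z2 : 0 <= v2 z by apply/polecoef_eq0/(hz v2 p2 ne2 ne21).
have reg w : is_place iota w -> w <> vinf -> w <> v1 -> w <> v2 -> 0 <= w (ev A / psi D).
  by move=> pw w0 w1 w2; rewrite -zE; apply/polecoef_eq0/hz.
have := degree_bound A0 Am D0 reg Ai; have := l2 i Ai; have := l0 i Ai.
rewrite -zE in e1 *; rewrite !mul1r in e1 *.
have -> : kappa_inf A`_i - kappa_inf D = - (kappa_inf D - kappa_inf A`_i) by rewrite opprB.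
move: (kappa_at a1 _ - _) (kappa_at a2 _ - _) (kappa_inf D - _) e1 => k1 k2 k0 e1 b0 b2 b3.
exists i, k1; split=> //; first by rewrite -vz1.
(* Regularity at the second ramified place makes [k2] nonnegative, so [k1] alone is bounded by the
   degree [k0] of the coefficient. *)
have k2_ge0 : 0 <= k2 by apply: (div_nonneg im); apply: le_trans z2 b2.
have : m%:Z * k1 <= m%:Z * k0 by rewrite ler_pM2l //; apply: le_trans b3; rewrite lerDl.
clear - b0 vz0; lia.
Qed.

(** Now the term attains the value at infinity, and the exponent is the degree [k0] of its
    coefficient rather than an order at a root. Since [k1 <= k0], the replacement is no worse at the
    ramified point. *)
Lemma inf_necessary0 n0 n1 : inH2 iota vinf v1 (n0, n1) -> inf_cond0 m r n0 n1.
Proof.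
case=> z [/= h0 h1 hz] n00.
have [A [D [Am D0 zE]]] := normal_form m_gt0 psi_neq0 y_eq generated z.
have vz0 : vinf z = - n0%:Z by apply/polecoefE.
have vz1 := polecoef_ge h1.
have A0 : A != 0.
  by apply/eqP => A0; move: vz0; rewrite zE A0 rmorph0 mul0r (place0 pinf); lia.
have [_ _ l1] := valued_min m_gt0 f_sep f_size co_mr psi_neq0 y_eq V1 A0 Am D0.
have [_ _ l2] := valued_min m_gt0 f_sep f_size co_mr psi_neq0 y_eq V2 A0 Am D0.
have [_ [i [im Ai e0]] _] := valued_min m_gt0 f_sep f_size co_mr psi_neq0 y_eq infV A0 Am D0.
have z2 : 0 <= v2 z by apply/polecoef_eq0/(hz v2 p2 ne2 ne21).
have reg w : is_place iota w -> w <> vinf -> w <> v1 -> w <> v2 -> 0 <= w (ev A / psi D).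
  by move=> pw w0 w1 w2; rewrite -zE; apply/polecoef_eq0/hz.
have := degree_bound A0 Am D0 reg Ai; have := l2 i Ai; have := l1 i Ai.
rewrite -zE in e0 *; rewrite !mul1r => b1 b2 b3.
have E : kappa_inf A`_i - kappa_inf D = - (kappa_inf D - kappa_inf A`_i) by rewrite opprB.
rewrite E in e0; exists i, (kappa_inf D - kappa_inf A`_i); move: e0.
move: (kappa_at a1 _ - _) (kappa_at a2 _ - _) (kappa_inf D - _) b1 b2 b3 => k1 k2 k0 b1 b2 b3 e0.
split=> //; first by move: e0; rewrite vz0; clear; lia.
have k2_ge0 : 0 <= k2 by apply: (div_nonneg im); apply: le_trans z2 b2.
have : m%:Z * k1 <= m%:Z * k0 by rewrite ler_pM2l //; apply: le_trans b3; rewrite lerDl.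
clear - b1 vz1; lia.
Qed.

Lemma inf_sufficient n0 n1 : inf_cond0 m r n0 n1 -> inf_cond1 m r n0 n1 ->
  inH2 iota vinf v1 (n0, n1).
Proof.
move=> c0 c1.
have reg k i : regular_off iota vinf v1 (monomial k 0 i).
  move=> w pw w0 w1; have [->|w2] := classic (w = v2).
    by rewrite v2_monomial mulr0 add0r.
  exact: monomial_regular.
have [T0 h0] : exists T0, (0 < n0)%N ->
    [/\ vinf T0 = - n0%:Z, - n1%:Z <= v1 T0 & regular_off iota vinf v1 T0].
  case: (posnP n0) => [->|n00]; first by exists 0.
  have [i [k [im e l]]] := c0 n00; exists (monomial k 0 i) => _.
  by rewrite vinf_monomial v1_monomial addr0 e; split.
have [T1 h1] : exists T1, (0 < n1)%N ->
    [/\ v1 T1 = - n1%:Z, - n0%:Z <= vinf T1 & regular_off iota vinf v1 T1].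
  case: (posnP n1) => [->|n10]; first by exists 0.
  have [i [k [im e l]]] := c1 n10; exists (monomial k 0 i) => _.
  by rewrite vinf_monomial v1_monomial addr0 e; split=> //; rewrite lerN2.
exact: (@inH2_sum K F iota vinf v1 (n0, n1) T0 T1 pinf p1 h0 h1).
Qed.

Lemma ram_sufficient n1 n2 : ram_cond m r n1 n2 -> ram_cond m r n2 n1 ->
  inH2 iota v1 v2 (n1, n2).
Proof.
move=> c1 c2.
have reg k1 k2 i : m%:Z * (k1 + k2) + r%:Z * i%:Z <= 0 ->
    regular_off iota v1 v2 (monomial k1 k2 i).
  move=> le w pw w1 w2; have [->|w0] := classic (w = vinf).
    by rewrite vinf_monomial oppr_ge0.
  exact: monomial_regular.
have [T1 h1] : exists T1, (0 < n1)%N ->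
    [/\ v1 T1 = - n1%:Z, - n2%:Z <= v2 T1 & regular_off iota v1 v2 T1].
  case: (posnP n1) => [->|n10]; first by exists 0.
  have [i [k1 [k2 [im e l le]]]] := c1 n10; exists (monomial k1 k2 i) => _.
  by rewrite v2_monomial v1_monomial e; split=> //; apply: reg.
have [T2 h2] : exists T2, (0 < n2)%N ->
    [/\ v2 T2 = - n2%:Z, - n1%:Z <= v1 T2 & regular_off iota v1 v2 T2].
  case: (posnP n2) => [->|n20]; first by exists 0.
  have [i [k2 [k1 [im e l le]]]] := c2 n20; exists (monomial k1 k2 i) => _.
  by rewrite v2_monomial v1_monomial e; split=> //; apply: reg; rewrite (addrC k1).
exact: (@inH2_sum K F iota v1 v2 (n1, n2) T1 T2 p1 p2 h1 h2).
Qed.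

End TwoRoots.
End KummerCurve.

(** In each last factor the negative terms are gathered behind one subtraction of natural numbers,
    which is exact because [r] is positive. *)
Theorem theorem3p2 (K : finFieldType) (F : fieldType) (iota : {rmorphism K -> F})
  (m r u : nat) (f : {poly K}) (x y : F) (vinf v1 v2 : F -> int) :
  (2 <= m)%N -> (m%:R : K) != 0 ->
  separable_poly f -> size f = r.+1 -> coprime m r ->
  (forall p : {poly K}, p != 0 -> (map_poly iota p).[x] != 0) ->
  y ^+ m = (map_poly iota f).[x] ->
  (forall z : F, exists P Q : {poly {poly K}},
      evalXY iota Q x y != 0 /\ z = evalXY iota P x y / evalXY iota Q x y) ->
  (0 < u)%N -> m = (u * r).+1 ->
  is_place iota vinf -> vinf x < 0 ->
  is_rational_place iota v1 -> is_rational_place iota v2 ->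
  v1 <> v2 -> v1 <> vinf -> v2 <> vinf ->
  totally_ramified_over iota x m v1 -> totally_ramified_over iota x m v2 ->
  (exists N, num_gaps2 iota v1 v2 N /\
     (12 * N = u * r * (r - 1) * ((3 * u * r ^ 2 + 4 * r + 4 * u) - (5 * u * r + 2)))%N)
  /\
  (exists N, num_gaps2 iota vinf v1 N /\
     (12 * N = u * r * (r - 1) * ((3 * u * r ^ 2 + 2 * r + 2) - 3 * u * r))%N).
Proof.
move=> m2 mK fsep fsize co psi0 yeq gen u0 mE pinf vx rat1 rat2 ne12 ne1 ne2 ram1 ram2.
have m_gt0 : (0 < m)%N by apply: ltnW.
have gen' z : exists P Q, ev iota x y Q != 0 /\ z = ev iota x y P / ev iota x y Q.
  by have [P [Q]] := gen z; rewrite !evalXYE; exists P, Q.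
case: r => [|n] in fsize co mE *; first by rewrite mE muln0 in m2.
have [a1 [fa1 va1]] := totally_ramified_root m_gt0 fsep fsize co psi0 yeq gen' m2 mK
  pinf vx rat1 ram1 ne1.
have [a2 [fa2 va2]] := totally_ramified_root m_gt0 fsep fsize co psi0 yeq gen' m2 mK
  pinf vx rat2 ram2 ne2.
have [[p1 _] [p2 _]] := (rat1, rat2).
have a12 : a1 != a2.
  apply/eqP => E; apply: ne12; rewrite -E in fa2 va2.
  apply: (valued_uniq m_gt0 fsep fsize co psi0 yeq gen').
    exact: (valued_root m_gt0 fsep fsize co psi0 yeq gen' p1 fa1 va1).
  exact: (valued_root m_gt0 fsep fsize co psi0 yeq gen' p2 fa2 va2).
(* A finite field is countable, so an algebraic closure is available to carry the branches. *)
have [L [emb _]] := countable_algebraic_closure K.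
have a21 : a2 != a1 by rewrite eq_sym.
split.
  have [G [uG memG szG]] := gaps_ram u n; exists (size G); split; last by rewrite subn1.
  exists G; split=> // -[n1 n2].
  have H : inH2 iota v1 v2 (n1, n2) <-> ram_cond m n.+1 n1 n2 /\ ram_cond m n.+1 n2 n1.
    split=> [h|[c1 c2]]; last first.
      exact: (ram_sufficient m_gt0 mK fsep fsize co psi0 yeq gen' pinf vx a12 fa1 fa2 p1 p2 va1 va2).
    split; first exact: (ram_necessary emb m_gt0 mK fsep fsize co psi0 yeq gen' pinf vx
      a12 fa1 fa2 p1 p2 va1 va2).
    exact: (ram_necessary emb m_gt0 mK fsep fsize co psi0 yeq gen' pinf vx
      a21 fa2 fa1 p2 p1 va2 va1 (inH2C h)).
  rewrite memG H mE; have nc := not_ram_cond n _ _ u0; split.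
    case=> j [k [t [h1 h2 h3 h4 [[e l]|[e l]]]]] [c1 c2].
      by apply: (proj2 (nc n2 n1)) c2; exists j, k, t.
    by apply: (proj2 (nc n1 n2)) c1; exists k, j, t; rewrite addnC.
  move=> /not_and_or[] /nc[j [k [t [[h1 h2 h3 h4] [e l]]]]].
    by exists k, j, t; rewrite addnC; split=> //; right.
  by exists j, k, t; split=> //; left.
have [G [uG memG szG]] := gaps_inf u n; exists (size G); split; last by rewrite subn1.
exists G; split=> // -[n0 n1].
have H : inH2 iota vinf v1 (n0, n1) <-> inf_cond0 m n.+1 n0 n1 /\ inf_cond1 m n.+1 n0 n1.
  split=> [h|[c0 c1]]; last first.
    exact: (inf_sufficient m_gt0 mK fsep fsize co psi0 yeq gen' pinf vx a12 fa1 fa2 p1 p2 va1 va2).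
  split; first exact: (inf_necessary0 emb m_gt0 mK fsep fsize co psi0 yeq gen' pinf vx
    a12 fa1 fa2 p1 p2 va1 va2).
  exact: (inf_necessary1 emb m_gt0 mK fsep fsize co psi0 yeq gen' pinf vx
    a12 fa1 fa2 p1 p2 va1 va2).
rewrite memG H mE; split.
  case=> j [s [h1 h2 [[e l]|[e l]]]] [c0 c1].
    by apply: (proj2 (not_inf_cond1 n n0 n1 u0)) c1; exists j, s.
  by apply: (proj2 (not_inf_cond0 n n0 n1 u0)) c0; exists j, s.
move=> /not_and_or[/(not_inf_cond0 _ _ _ u0)|/(not_inf_cond1 _ _ _ u0)][j [s [h1 h2 e l]]].
  by exists j, s; split=> //; right.
by exists j, s; split=> //; left.
Qed.
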